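(* Let $\mathbf{X}$ be the discrete space $\Sigma^*$ of finite strings over a finite alphabet $\Sigma$, and let $\mathbf{d}_\mu(x)=\log_2\mathbf{t}_\mu(x)$ for a fixed universal randomness test $\mathbf{t}$. Then there is a constant $c$ such that for all probability measures $\mu$ on $\Sigma^*$ and all $x\in\Sigma^*$, $$\bigl|\mathbf{d}_\mu(x)-\bigl(-\log_2\mu(x)-H(x\mid\mu)\bigr)\bigr|\le c.$$
   Context: $\Sigma^*$ carries the discrete metric ($d(x,y)=1$ for $x\neq y$). $\mathcal{M}(\mathbf{X})$: probability measures on $\Sigma^*$ with the weak topology, a computable metric space under the Prokhorov distance with dense set the finitely supported rational-weight measures; a measure is represented by (all of) its Cauchy sequences of such measures. A randomness test is a lower semicomputable $(\mu,x)\mapsto f_\mu(x)\in[0,\infty]$ with $\sum_x\mu(x)f_\mu(x)\le1$ for all $\mu$; a universal test dominates every test up to a positive multiplicative constant. Conditional complexity given a measure: an interpreter is a map $A:\{0,1\}^*\times\mathcal{M}(\mathbf{X})\to\Sigma^*$ (partial) that is computable in the sense that it is realized by a computable function $B(p,z)$ on programs $p$ and names $z$ of $\mu$ whose output depends only on $p$ and $\mu$, and is prefix-free in the first argument (if $A(p_1,\mu),A(p_2,\mu)$ are both defined with $p_1\ne p_2$ then $p_1$ is not a prefix of $p_2$). There is an optimal interpreter $T$ (every interpreter $A$ satisfies $\min_{T(p,\mu)=x}|p|\le\min_{A(p,\mu)=x}|p|+c_A$); $H(x\mid\mu)=\min\{|p|:T(p,\mu)=x\}$. $\log_2 0=-\infty$.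 *)

(* Defs.v *)
From HB Require Import structures.
From Stdlib Require Cantor.
From mathcomp Require Import all_boot all_order all_algebra.
From mathcomp Require Import all_classical all_reals all_analysis.
Import Order.TTheory GRing.Theory Num.Theory.
Import numFieldTopology.Exports numFieldNormedType.Exports.

Set Implicit Arguments.
Unset Strict Implicit.
Unset Printing Implicit Defensive.

Local Open Scope classical_set_scope.
Local Open Scope ring_scope.

(** * Partial recursive functions with an oracle *)

Definition npair (a b : nat) : nat := Cantor.to_nat (a, b).
Definition nunpair (n : nat) : nat * nat := Cantor.of_nat n.

(* Unary partial recursive functions; several arguments are passed through the
   Cantor pairing.  [CRec f g] is primitive recursion on the second component
   of the argument, [CMin f] is unbounded minimization. *)
Inductive code : Type :=
| CZero
| CSucc
| CLeft
| CRight
| COracle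
| CPair of code & code
| CComp of code & code
| CRec of code & code
| CMin of code.

(* [computes o c n m]: on input [n] and with oracle [o], [c] halts with
   output [m]. *)
Fixpoint computes (o : nat -> nat) (c : code) (n m : nat) : Prop :=
  match c with
  | CZero => m = 0%N
  | CSucc => m = n.+1
  | CLeft => m = (nunpair n).1
  | CRight => m = (nunpair n).2
  | COracle => m = o n
  | CPair f g =>
      exists a b, [/\ computes o f n a, computes o g n b & m = npair a b]
  | CComp f g => exists2 k, computes o g n k & computes o f k m
  | CRec f g =>
      let a := (nunpair n).1 in
      let fix iter (k r : nat) : Prop :=
        if k is k'.+1 then
          exists2 r', iter k' r' & computes o g (npair a (npair k' r')) r
        else computes o f a r in
      iter (nunpair n).2 m
  | CMin f =>
      computes o f (npair n m) 0%N /\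
      forall k, (k < m)%N -> exists r, computes o f (npair n k) r.+1
  end.

Definition comp_enumerable (S : set nat) : Prop :=
  exists c : code, forall n, S n <-> exists m, computes (fun=> 0%N) c n m.

(** * The discrete space of words *)

Definition word (Sigma : finType) : Type := seq Sigma.

HB.instance Definition _ (Sigma : finType) := Choice.on (word Sigma).
HB.instance Definition _ (Sigma : finType) :=
  isPointed.Build (word Sigma) [::].
HB.instance Definition _ (Sigma : finType) :=
  @isMeasurable.Build default_measure_display (word Sigma)
    discrete_measurable discrete_measurable0
    discrete_measurableC discrete_measurableU.

Fixpoint encode_seq (s : seq nat) : nat :=
  if s is n :: s' then (npair n (encode_seq s')).+1 else 0%N.

(* The letters are numbered by [enum_rank]; as [Sigma] is finite, any other
   numbering yields the same notion of computability. *)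
Definition encode_word (Sigma : finType) (x : word Sigma) : nat :=
  encode_seq [seq nat_of_ord (enum_rank a) | a <- x].

Definition encode_prog (p : seq bool) : nat :=
  encode_seq [seq nat_of_bool b | b <- p].

(** * The computable metric space of probability measures *)

Section Measures.
Variables (R : realType) (Sigma : finType).
Local Notation W := (word Sigma).
Local Notation M := (probability W R).

Definition word_dist (x y : W) : R := (x != y)%:R.

Definition fattening (e : R) (A : set W) : set W :=
  [set y | exists2 x, A x & word_dist x y < e].

Definition prokhorov (mu nu : M) : R :=
  inf [set e : R | 0 < e /\ forall A : set W, measurable A ->
    (mu A <= nu (fattening e A) + e%:E)%E /\
    (nu A <= mu (fattening e A) + e%:E)%E].

(* A list of pairs (x_i, n_i) denotes the measure
   (sum_i n_i delta_(x_i)) / (sum_i n_i); these are all the finitely supported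
   probability measures with rational weights.  Lists of total weight 0 are
   harmless: they denote the Dirac measure at the empty word. *)
Definition ideal_measure (s : seq (W * nat)) : M :=
  mnormalize
    (msum (fun i => let a := nth (point, 0%N) s i in
                    mscale (a.2%:R : R)%:nng (dirac a.1)) (size s))
    (dirac (point : W)).

Lemma ideal_measureE (s : seq (W * nat)) (A : set W) :
  (0 < \sum_(a <- s) a.2)%N ->
  ideal_measure s A =
    ((\sum_(a <- s) a.2%:R * \1_A a.1) / (\sum_(a <- s) a.2)%:R)%:E.
Proof.
move=> s0.
have E (U : set W) :
    @msum _ _ R (fun i => mscale (((nth (point, 0%N) s i).2%:R : R)%:nng)
       (dirac (nth (point, 0%N) s i).1)) (size s) U =
    (\sum_(a <- s) a.2%:R * \1_U a.1)%:E.
  rewrite /msum (big_nth (point, 0%N)) big_mkord -sumEFin.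
  by apply: eq_bigr => i _; rewrite EFinM /mscale/= /dirac.
have ET := E setT.
rewrite (_ : \sum_(a <- s) _ = (\sum_(a <- s) a.2)%:R) in ET; last first.
  by rewrite natr_sum; apply: eq_bigr => a _; rewrite indicE in_setT mulr1.
move: E ET.
rewrite /ideal_measure /= /mnormalize /= => E ->.
rewrite ifF ?E ?EFinM //.
by apply/negbTE; rewrite negb_or eqe pnatr_eq0 -lt0n s0.
Qed.

Definition encode_ideal (s : seq (W * nat)) : nat :=
  encode_seq [seq npair (encode_word a.1) a.2 | a <- s].

(* The names of [mu] are all the Cauchy sequences of ideal measures, with the
   usual rate 2^-i, that converge to [mu]. *)
Definition name (z : nat -> nat) (mu : M) : Prop :=
  exists s : nat -> seq (W * nat),
    [/\ forall i, z i = encode_ideal (s i),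
        forall i j, (i <= j)%N ->
          prokhorov (ideal_measure (s i)) (ideal_measure (s j)) <= 2^-1 ^+ i
      & (fun i => prokhorov (ideal_measure (s i)) mu) @ \oo --> (0 : R)].

(** * Randomness tests *)

Definition nnrat (q : nat * nat) : R := q.1%:R / q.2.+1%:R.

(* The superlevel set {(mu, x) | r < f mu x} is, uniformly in the rational
   r >= 0, a computably enumerable union of basic open sets B(s, q) x {x} with
   ideal center s and rational radius q.  Only used for f >= 0. *)
Definition lower_semicomputable (f : M -> W -> \bar R) : Prop :=
  exists2 S : set nat, comp_enumerable S &
    forall (mu : M) (x : W) (r : nat * nat),
      ((nnrat r)%:E < f mu x)%E <->
      exists (s : seq (W * nat)) (q : nat * nat),
        S (encode_seq [:: encode_word x; r.1; r.2; encode_ideal s; q.1; q.2])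
        /\ prokhorov (ideal_measure s) mu < nnrat q.

Definition randomness_test (f : M -> W -> \bar R) : Prop :=
  [/\ forall mu x, (0 <= f mu x)%E,
      lower_semicomputable f
    & forall mu : M, (\esum_(x in [set: W]) (mu [set x] * f mu x) <= 1)%E].

Definition universal_test (t : M -> W -> \bar R) : Prop :=
  randomness_test t /\
  forall f, randomness_test f ->
    exists2 C : R, 0 < C & forall mu x, (C%:E * f mu x <= t mu x)%E.

(** * Conditional complexity *)

(* The realizer halts on a program and a name of [mu] exactly when the
   interpreter is defined, and then returns the same word for every name. *)
Definition interpreter (A : seq bool -> M -> option W) : Prop :=
  (exists B : code, forall (mu : M) (z : nat -> nat), name z mu ->
     forall (p : seq bool) (m : nat),
       computes z B (encode_prog p) m <->
       exists2 x : W, A p mu = Some x & m = encode_word x) /\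
  (forall (mu : M) (p1 p2 : seq bool),
     A p1 mu -> A p2 mu -> p1 <> p2 -> ~~ prefix p1 p2).

(* The minimum of the empty set is +oo. *)
Definition complexity (A : seq bool -> M -> option W) (x : W) (mu : M) :
    \bar R :=
  ereal_inf [set (size p)%:R%:E | p in [set p | A p mu = Some x]].

Definition optimal_interpreter (T : seq bool -> M -> option W) : Prop :=
  interpreter T /\
  forall A, interpreter A ->
    exists c : R, forall mu x,
      (complexity T x mu <= complexity A x mu + c%:E)%E.

End Measures.

(** * Logarithms and distances of extended reals *)

(* [lne 0] is -oo *)
Definition log2e (R : realType) (y : \bar R) : \bar R :=
  (lne y * ((ln 2)^-1)%:E)%E.

(* The absolute difference |x - y|, with the convention that it is 0 when
   x = y = +oo; in the library (+oo - +oo)%E is -oo. *)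
Definition abs_diff (R : realType) (x y : \bar R) : \bar R :=
  (if x == y then 0 else `|x - y|)%E.

(* Main.v *)
(* Lower bound: 2^-H(x|mu) / mu(x) is a randomness test.  Kraft's inequality
   bounds its mean, and it is lower semicomputable because a halting computation
   reads a finite part of a name, which is also the beginning of a name of every
   measure in some ball.

   Upper bound: mu(x) t_mu(x) has total mass at most 1, and a prefix-free
   interpreter must code it with words of length -log(mu(x) t_mu(x)) + O(1).
   The code has to depend on mu alone and not on its name, which excludes the
   usual Kraft-Chaitin allocation in the order of enumeration.  Instead the words
   are placed in consecutive intervals whose end points are computable Lipschitz
   functions of mu.  Each scale 2^-k of each word x gets an increasing sequence of
   ramp functions, supported where mu(x) t_mu(x) > 2^-k, whose steps are the
   widths of the intervals; the ramps at least double until they reach 1, so one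
   of the steps is large.  A program is a dyadic interval of the length fixed by
   k that lies strictly inside one of the intervals, a condition that is
   semidecidable from any name. *)

Require Import Defs.
From Stdlib Require Cantor.
From mathcomp Require Import all_boot all_order all_algebra zify ring lra.
From mathcomp Require Import all_classical all_reals all_analysis.

Set Implicit Arguments.
Unset Strict Implicit.
Unset Printing Implicit Defensive.

Import Order.TTheory GRing.Theory Num.Theory.
Import numFieldTopology.Exports numFieldNormedType.Exports.

Local Open Scope classical_set_scope.
Local Open Scope nat_scope.

(** * Total recursive functionals *)

(** The code does not depend on the name because the place of a piece is fixed by its index alone:
    all triples (word, scale, step) are laid out once and for all, and those that a given measure
    does not use get width 0. A superlevel set is a union of overlapping balls, so giving each ball
    its full width would count overlaps repeatedly; the steps of an increasing sequence bounded by 1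
    telescope instead, which keeps the total width at most 1. Telescoping alone could crumble the
    width into arbitrarily small steps, and this is what the doubling prevents. Membership in a ball
    is only semidecidable, so the widths have to vary continuously with the measure; their Lipschitz
    constants are explicit because the realizer must know how far an end point computed from one
    entry of a name can be off. It confirms strict inclusions only, hence never has to decide
    whether a piece is empty. *)

Lemma npairK a b : nunpair (npair a b) = (a, b).
Proof. exact: Cantor.cancel_of_to. Qed.

Lemma nunpairK n : npair (nunpair n).1 (nunpair n).2 = n.
Proof. by rewrite /npair -surjective_pairing; exact: Cantor.cancel_to_of. Qed.

Lemma npair_ge a b : a + b <= npair a b.
Proof. have := Cantor.to_nat_non_decreasing a b; rewrite /npair; lia. Qed.

Lemma nunpair_le1 n : (nunpair n).1 <= n.
Proof. by have := npair_ge (nunpair n).1 (nunpair n).2; rewrite nunpairK; lia. Qed.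

Lemma nunpair_le2 n : (nunpair n).2 <= n.
Proof. by have := npair_ge (nunpair n).1 (nunpair n).2; rewrite nunpairK; lia. Qed.

Arguments npair : simpl never.
Arguments nunpair : simpl never.
Opaque npair nunpair.

Lemma npair_inj a b a' b' : npair a b = npair a' b' -> a = a' /\ b = b'.
Proof. by move=> /(congr1 nunpair); rewrite !npairK => -[]. Qed.

Lemma computes_det (o : nat -> nat) (c : Defs.code) (n m m' : nat) :
  computes o c n m -> computes o c n m' -> m = m'.
Proof.
elim: c n m m' => /=; try by move=> n m m' -> ->.
- move=> f IHf g IHg n m m' [a [b [fa gb ->]]] [a' [b' [fa' gb' ->]]].
  by rewrite (IHf _ _ _ fa fa') (IHg _ _ _ gb gb').
- move=> f IHf g IHg n m m' [k gk fk] [k' gk' fk'].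
  by rewrite (IHg _ _ _ gk gk') in fk; exact: IHf fk fk'.
- move=> f IHf g IHg n; elim: (nunpair n).2 => [|k IHk] m m' /=; first exact: IHf.
  move=> [r rk gr] [r' rk' gr'].
  by rewrite (IHk _ _ rk rk') in gr; exact: IHg gr gr'.
- move=> f IHf n m m' [fm ltm] [fm' ltm'].
  case: (ltngtP m m') => // lt.
    by have [r fr] := ltm' _ lt; have := IHf _ _ _ fm fr.
  by have [r fr] := ltm _ lt; have := IHf _ _ _ fm' fr.
Qed.

(** Totality is required for every oracle, also for those that name no measure, so that composition
    needs no care about domains. Partiality enters only through the final search in [rec_search]. *)
Definition rec (F : (nat -> nat) -> nat -> nat) : Prop :=
  exists c, forall o n, computes o c n (F o n).

Lemma rec_ext F G : (forall o e, F o e = G o e) -> rec F -> rec G.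
Proof. by move=> FG [c cF]; exists c => o n; rewrite -FG. Qed.

Lemma rec_comp F G : rec F -> rec G -> rec (fun o e => F o (G o e)).
Proof. by move=> [f cf] [g cg]; exists (CComp f g) => o n /=; exists (G o n). Qed.

Lemma rec_pair F G : rec F -> rec G -> rec (fun o e => npair (F o e) (G o e)).
Proof.
by move=> [f cf] [g cg]; exists (CPair f g) => o n /=; exists (F o n), (G o n).
Qed.

Lemma rec_fst F : rec F -> rec (fun o e => (nunpair (F o e)).1).
Proof. by apply: (@rec_comp (fun o e => (nunpair e).1)); exists CLeft. Qed.

Lemma rec_snd F : rec F -> rec (fun o e => (nunpair (F o e)).2).
Proof. by apply: (@rec_comp (fun o e => (nunpair e).2)); exists CRight. Qed.

Lemma rec_id : rec (fun o e => e).
Proof.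
by exists (CPair CLeft CRight) => o n /=; exists (nunpair n).1, (nunpair n).2;
  rewrite nunpairK.
Qed.

Lemma rec_succ F : rec F -> rec (fun o e => (F o e).+1).
Proof. by apply: (@rec_comp (fun o e => e.+1)); exists CSucc. Qed.

Lemma rec_const k : rec (fun o e => k).
Proof. by elim: k => [|k IHk]; [exists CZero | exact: rec_succ]. Qed.

Lemma rec_oracle F : rec F -> rec (fun o e => o (F o e)).
Proof. by apply: (@rec_comp (fun o e => o e)); exists COracle. Qed.

Fixpoint primrec (a : nat) (g : nat -> nat -> nat) (k : nat) : nat :=
  if k is k'.+1 then g k' (primrec a g k') else a.

(* The argument of the step function packs the environment, the counter and
   the previous value. *)
Lemma rec_primrec A G N : rec A ->
  rec (fun o n => G o (nunpair n).1 (nunpair (nunpair n).2).1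
                                    (nunpair (nunpair n).2).2) ->
  rec N -> rec (fun o e => primrec (A o e) (G o e) (N o e)).
Proof.
move=> [a ca] [g cg] recN.
have recP : rec (fun o n => primrec (A o (nunpair n).1) (G o (nunpair n).1)
                                    (nunpair n).2).
  exists (CRec a g) => o n /=.
  elim: (nunpair n).2 => [|k IHk] //=; eexists; first exact: IHk.
  by have := cg o (npair (nunpair n).1 (npair k
    (primrec (A o (nunpair n).1) (G o (nunpair n).1) k))); rewrite !npairK.
have := rec_comp recP (rec_pair rec_id recN).
by apply: rec_ext => o e; rewrite !npairK.
Qed.

Create HintDb rec.
#[export] Hint Resolve rec_id rec_const rec_pair rec_fst rec_snd rec_succ
  rec_oracle : rec.

Ltac rec_auto := auto 100 with rec nocore.

Lemma rec_pred F : rec F -> rec (fun o e => (F o e).-1).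
Proof.
move=> rF; apply: (@rec_ext (fun o e => primrec 0 (fun k r => k) (F o e))).
  by move=> o e; case: (F o e).
by apply: (@rec_primrec _ (fun o e k r => k)); rec_auto.
Qed.
#[export] Hint Resolve rec_pred : rec.

Lemma rec_add F G : rec F -> rec G -> rec (fun o e => F o e + G o e).
Proof.
move=> rF rG.
apply: (@rec_ext (fun o e => primrec (F o e) (fun k r => r.+1) (G o e))).
  by move=> o e; elim: (G o e) => [|k /= ->]; rewrite ?addn0 ?addnS.
by apply: (@rec_primrec _ (fun o e k r => r.+1)); rec_auto.
Qed.
#[export] Hint Resolve rec_add : rec.

Lemma rec_sub F G : rec F -> rec G -> rec (fun o e => F o e - G o e).
Proof.
move=> rF rG.
apply: (@rec_ext (fun o e => primrec (F o e) (fun k r => r.-1) (G o e))).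
  by move=> o e; elim: (G o e) => [|k /= ->]; rewrite ?subn0 ?subnS.
by apply: (@rec_primrec _ (fun o e k r => r.-1)); rec_auto.
Qed.
#[export] Hint Resolve rec_sub : rec.

Lemma rec_mul F G : rec F -> rec G -> rec (fun o e => F o e * G o e).
Proof.
move=> rF rG.
apply: (@rec_ext (fun o e => primrec 0 (fun k r => F o e + r) (G o e))).
  by move=> o e; elim: (G o e) => [|k /= ->]; rewrite ?muln0 ?mulnS.
apply: (@rec_primrec _ (fun o e k r => F o e + r)); rec_auto.
by apply: rec_add; [apply: rec_comp|]; rec_auto.
Qed.
#[export] Hint Resolve rec_mul : rec.

Lemma rec_exp F G : rec F -> rec G -> rec (fun o e => F o e ^ G o e).
Proof.
move=> rF rG.
apply: (@rec_ext (fun o e => primrec 1 (fun k r => F o e * r) (G o e))).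
  by move=> o e; elim: (G o e) => [|k /= ->]; rewrite ?expn0 ?expnS.
apply: (@rec_primrec _ (fun o e k r => F o e * r)); rec_auto.
by apply: rec_mul; [apply: rec_comp|]; rec_auto.
Qed.
#[export] Hint Resolve rec_exp : rec.

Lemma rec_not F : rec (fun o e => nat_of_bool (F o e)) ->
  rec (fun o e => nat_of_bool (~~ F o e)).
Proof.
move=> rF; apply: (@rec_ext (fun o e => 1 - nat_of_bool (F o e))); rec_auto.
by move=> o e; case: (F o e).
Qed.

Lemma rec_and F G : rec (fun o e => nat_of_bool (F o e)) ->
  rec (fun o e => nat_of_bool (G o e)) ->
  rec (fun o e => nat_of_bool (F o e && G o e)).
Proof.
move=> rF rG.
apply: (@rec_ext (fun o e => nat_of_bool (F o e) * nat_of_bool (G o e))); rec_auto.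
by move=> o e; case: (F o e); case: (G o e).
Qed.

Lemma rec_or F G : rec (fun o e => nat_of_bool (F o e)) ->
  rec (fun o e => nat_of_bool (G o e)) ->
  rec (fun o e => nat_of_bool (F o e || G o e)).
Proof.
move=> rF rG; apply: (@rec_ext (fun o e =>
    nat_of_bool (~~ (~~ F o e && ~~ G o e)))).
  by move=> o e; case: (F o e); case: (G o e).
by apply/rec_not/rec_and; apply: rec_not.
Qed.

Lemma rec_leq F G : rec F -> rec G -> rec (fun o e => nat_of_bool (F o e <= G o e)).
Proof.
move=> rF rG; apply: (@rec_ext (fun o e => 1 - (F o e - G o e))); rec_auto.
by move=> o e; case: leqP; lia.
Qed.
#[export] Hint Resolve rec_not rec_and rec_or rec_leq : rec.

Lemma rec_ltn F G : rec F -> rec G -> rec (fun o e => nat_of_bool (F o e < G o e)).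
Proof. by move=> rF rG; apply: rec_leq; rec_auto. Qed.

Lemma rec_eqn F G : rec F -> rec G -> rec (fun o e => nat_of_bool (F o e == G o e)).
Proof.
move=> rF rG; apply: (@rec_ext (fun o e =>
    nat_of_bool ((F o e <= G o e) && (G o e <= F o e)))); rec_auto.
by move=> o e; rewrite -eqn_leq.
Qed.

Lemma rec_if (C : (nat -> nat) -> nat -> bool) F G :
  rec (fun o e => nat_of_bool (C o e)) -> rec F -> rec G ->
  rec (fun o e => if C o e then F o e else G o e).
Proof.
move=> rC rF rG; apply: (@rec_ext (fun o e =>
   C o e * F o e + (~~ C o e) * G o e)); rec_auto.
by move=> o e; case: (C o e); rewrite ?mul1n ?mul0n ?addn0.
Qed.
#[export] Hint Resolve rec_ltn rec_eqn rec_if : rec.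

Definition bsum (N : nat) (f : nat -> nat) : nat := \sum_(i < N) f i.

Lemma rec_sum (G : (nat -> nat) -> nat -> nat -> nat) N :
  rec (fun o n => G o (nunpair n).1 (nunpair n).2) -> rec N ->
  rec (fun o e => bsum (N o e) (G o e)).
Proof.
move=> rG rN; rewrite /bsum.
apply: (@rec_ext (fun o e => primrec 0 (fun k r => r + G o e k) (N o e))).
  by move=> o e; elim: (N o e) => [|k /= ->]; rewrite ?big_ord0 ?big_ord_recr.
apply: (@rec_primrec _ (fun o e k r => r + G o e k)); rec_auto.
apply: rec_add; rec_auto.
have := @rec_comp _ (fun o e => npair (nunpair e).1 (nunpair (nunpair e).2).1) rG.
by move=> /(_ ltac:(rec_auto)); apply: rec_ext => o e; rewrite !npairK.
Qed.

Definition ball_all (N : nat) (P : nat -> bool) : bool := all P (iota 0 N).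

Lemma ball_allP (N : nat) (P : nat -> bool) : reflect (forall i, i < N -> P i) (ball_all N P).
Proof.
apply: (iffP allP) => [H i iN|H i]; first by apply: H; rewrite mem_iota.
by rewrite mem_iota => /andP[_]; apply: H.
Qed.

Lemma rec_ball (P : (nat -> nat) -> nat -> nat -> bool) N :
  rec (fun o n => nat_of_bool (P o (nunpair n).1 (nunpair n).2)) -> rec N ->
  rec (fun o e => nat_of_bool (ball_all (N o e) (P o e))).
Proof.
move=> rP rN.
apply: (@rec_ext (fun o e => nat_of_bool (bsum (N o e) (fun i => ~~ P o e i) <= 0))).
  move=> o e; congr nat_of_bool; rewrite /bsum leqn0 sum_nat_eq0.
  apply/forallP/ball_allP => [H i iN|H i].
    by have := H (Ordinal iN) => /=; rewrite eqb0 negbK.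
  by rewrite /= eqb0 negbK H.
apply: rec_leq; last rec_auto.
by apply: (@rec_sum (fun o e i => nat_of_bool (~~ P o e i))); rec_auto.
Qed.
#[export] Hint Resolve rec_sum rec_ball : rec.

(** The quotient counts the positive multiples of [G o e] up to [F o e]; the factor [0 < G o e]
    enforces the convention for division by 0. *)
Lemma rec_divn F G : rec F -> rec G -> rec (fun o e => F o e %/ G o e).
Proof.
move=> rF rG; apply: (@rec_ext (fun o e =>
   (0 < G o e) * bsum (F o e) (fun i => i.+1 * G o e <= F o e))).
  move=> o e; rewrite /bsum; case: (posnP (G o e)) => [->|G0]; first by rewrite divn0.
  rewrite mul1n; transitivity (\sum_(i < F o e) (i < F o e %/ G o e)).
    by apply: eq_bigr => i _; rewrite -leq_divRL.
  have := leq_div (F o e) (G o e).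
  elim: (F o e) (_ %/ _) => [|k IHk] d dk; first by rewrite big_ord0; lia.
  rewrite big_ord_recr /=; case: (ltngtP d k.+1) dk => // [dk|->] _.
    by rewrite IHk; lia.
  rewrite addn1 -[X in _ = X.+1](IHk k) //; congr S.
  by apply: eq_bigr => i _; rewrite ltnS (ltnW (ltn_ord i)) ltn_ord.
apply: rec_mul; rec_auto.
apply: (@rec_sum (fun o e i => nat_of_bool (i.+1 * G o e <= F o e))) => //.
by apply: rec_leq; [apply: rec_mul; rec_auto|]; apply: rec_comp; rec_auto.
Qed.
#[export] Hint Resolve rec_divn : rec.

(** * Bounded evaluation with a finite part of the oracle *)

(* [0] stands for "no result yet" and [m.+1] for the result [m]; the fuel bounds
   the oracle queries and the searches. *)
Fixpoint ev (c : Defs.code) (o : nat -> nat) (fuel n : nat) : nat :=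
  match c with
  | CZero => 1
  | CSucc => n.+2
  | CLeft => (nunpair n).1.+1
  | CRight => (nunpair n).2.+1
  | COracle => if n < fuel then (o n).+1 else 0
  | CPair f g =>
      if (0 < ev f o fuel n) && (0 < ev g o fuel n)
      then (npair (ev f o fuel n).-1 (ev g o fuel n).-1).+1 else 0
  | CComp f g => if 0 < ev g o fuel n then ev f o fuel (ev g o fuel n).-1 else 0
  | CRec f g =>
      primrec (ev f o fuel (nunpair n).1)
        (fun k r => if 0 < r
                    then ev g o fuel (npair (nunpair n).1 (npair k r.-1)) else 0)
        (nunpair n).2
  | CMin f =>
      (primrec 1 (fun k r => if r == 1 then
                    (if ev f o fuel (npair n k) == 1 then k.+2
                     else if ev f o fuel (npair n k) == 0 then 0 else 1)
                  else r) fuel).-1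
  end.

Section Search.
Variable h : nat -> nat.
(** States of the search in [ev]: 1 while all values so far are defined and positive, [m.+2] once a
    zero is found at [m], and 0 for good after an undefined value. As in [ev], [h k = 0] means
    undefined and [h k = 1] means the value 0. *)
Let search := primrec 1 (fun k r => if r == 1 then
                    (if h k == 1 then k.+2 else if h k == 0 then 0 else 1) else r).

Let searchS K : search K.+1 = if search K == 1 then
  (if h K == 1 then K.+2 else if h K == 0 then 0 else 1) else search K.
Proof. by []. Qed.

Lemma search_running K : search K = 1 <-> forall k, k < K -> 1 < h k.
Proof.
elim: K => [|K IHK]; first by split.
rewrite searchS; case: (search K =P 1) => [/IHK H|H].
  split => [HK k|/(_ K (ltnSn K)) HK]; last first.
    by case: eqP => [?|_]; [lia | case: eqP => [?|_] //; lia].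
  rewrite ltnS leq_eqVlt => /predU1P[->|/H//].
  by move: HK; case: eqP => // ?; case: eqP => // ?; lia.
by split => [//|HK]; case: H; apply/IHK => k kK; apply: HK; lia.
Qed.

Lemma search_found K m : search K = m.+2 <->
  [/\ m < K, h m = 1 & forall k, k < m -> 1 < h k].
Proof.
elim: K => [|K IHK]; first by split=> // -[].
rewrite searchS; case: (search K =P 1) => [/search_running H|H].
  split.
    by case: eqP => [hK [<-]|_]; [split | case: eqP].
  move=> [mK hm hlt]; have {mK} <- : m = K; last by rewrite hm.
  by case: (ltngtP m K) mK => // [/H|]; lia.
split=> [/IHK[mK hm hlt]|[mK hm hlt]]; first by split=> //; lia.
apply/IHK; split=> //; case: (ltngtP m K) mK => // [|mK]; first lia.
by case: H; apply/search_running => k; rewrite -mK; apply: hlt.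
Qed.
End Search.

(** Queries at or above the fuel are refused, so a result depends only on the oracle below it. This
    is what lets a finite part of a name be continued at will. *)
Lemma ev_sound (c : Defs.code) (o z : nat -> nat) fuel n m :
  (forall i, i < fuel -> z i = o i) -> ev c o fuel n = m.+1 -> computes z c n m.
Proof.
move=> zo; elim: c n m => /=; try by move=> n m [<-].
- by move=> n m; case: ifP => // /zo -> [].
- move=> f IHf g IHg n m; case: ifP => // /andP[f0 g0] [<-].
  exists (ev f o fuel n).-1, (ev g o fuel n).-1.
  by split=> //; [apply: IHf | apply: IHg]; rewrite prednK.
- move=> f IHf g IHg n m; case: ifP => // g0 fm; exists (ev g o fuel n).-1.
    by apply: IHg; rewrite prednK.
  exact: IHf.
- move=> f IHf g IHg n; elim: (nunpair n).2 => [|k IHk] m /=; first exact: IHf.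
  case: ifP => // r0 /IHg gm; eexists; last exact: gm.
  by apply: IHk; rewrite prednK.
- move=> f IHf n m; have predE r : r.-1 = m.+1 -> r = m.+2 by lia.
  move=> /predE /(search_found (fun k => ev f o fuel (npair n k)))[mK hm hlt].
  split; first exact: IHf.
  by move=> k /hlt; case E: (ev _ _ _ _) => [|[|r]] // _; exists r; apply: IHf.
Qed.

(** Asking for all large fuels, and not for one, lets the bounds of the subcomputations be added. *)
Lemma ev_complete (c : Defs.code) (z : nat -> nat) n m : computes z c n m ->
  exists N, forall fuel o, N <= fuel -> (forall i, i < fuel -> o i = z i) ->
    ev c o fuel n = m.+1.
Proof.
elim: c n m => /=; try by move=> n m ->; exists 0.
- by move=> n m ->; exists n.+1 => fuel o nf oz; rewrite nf oz.
- move=> f IHf g IHg n m [a [b [/IHf[N1 H1] /IHg[N2 H2] ->]]].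
  exists (N1 + N2) => fuel o Nf oz.
  by rewrite (H1 _ _ _ oz) ?(H2 _ _ _ oz) //; lia.
- move=> f IHf g IHg n m [k /IHg[N1 H1] /IHf[N2 H2]].
  exists (N1 + N2) => fuel o Nf oz.
  by rewrite (H1 _ _ _ oz) /= ?(H2 _ _ _ oz) //; lia.
- move=> f IHf g IHg n; elim: (nunpair n).2 => [|k IHk] m /=; first exact: IHf.
  move=> [r /IHk[N1 H1] /IHg[N2 H2]]; exists (N1 + N2) => fuel o Nf oz.
  by rewrite (H1 _ _ _ oz) /= ?(H2 _ _ _ oz) //; lia.
- move=> f IHf n m [/IHf[N1 H1] fr].
  have [N2 H2] : exists N, forall fuel o, N <= fuel ->
      (forall i, i < fuel -> o i = z i) ->
      forall k, k < m -> 1 < ev f o fuel (npair n k).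
    elim: m {H1} fr => [|m IHm] fr; first by exists 0.
    have [|N H] := IHm; first by move=> k km; apply: fr; lia.
    have [r /IHf[N' H']] := fr m (ltnSn m).
    exists (N + N') => fuel o Nf oz k; rewrite ltnS leq_eqVlt => /predU1P[->|km].
      by rewrite (H' _ _ _ oz) //; lia.
    by apply: (H _ _ _ oz) => //; lia.
  exists (m.+1 + N1 + N2) => fuel o Nf oz.
  have /(search_found (fun k => ev f o fuel (npair n k))) -> // :
    [/\ m < fuel, ev f o fuel (npair n m) = 1 &
        forall k, k < m -> 1 < ev f o fuel (npair n k)].
  by split; [lia | apply: (H1 _ _ _ oz); lia | apply: (H2 _ _ _ oz); lia].
Qed.

(** * Codes of sequences *)

Definition cdrop (s i : nat) : nat := primrec s (fun _ r => (nunpair r.-1).2) i.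
(** Past the end of the sequence this reads 0, because [nunpair 0] is [(0, 0)]. *)
Definition cnth (s i : nat) : nat := (nunpair (cdrop s i).-1).1.
Definition clen (s : nat) : nat := bsum s (fun i => cdrop s i != 0).

Lemma nunpair0 : nunpair 0 = (0, 0).
Proof.
have := nunpair_le1 0; have := nunpair_le2 0.
by case: (nunpair 0) => -[|a] [|b].
Qed.

Lemma cdropS s i : cdrop s i.+1 = (nunpair (cdrop s i).-1).2.
Proof. by []. Qed.

Lemma cdrop_encode l i : cdrop (encode_seq l) i = encode_seq (drop i l).
Proof.
elim: i => [|i IHi]; first by rewrite drop0.
rewrite cdropS IHi -[in RHS]addn1 addnC -drop_drop.
by case: (drop i l) => [|a l'] /=; rewrite ?nunpair0 ?npairK ?drop0.
Qed.

Lemma cnth_encode l i : cnth (encode_seq l) i = nth 0 l i.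
Proof.
rewrite /cnth cdrop_encode -[in RHS](addn0 i) -nth_drop.
by case: (drop i l) => [|a l'] /=; rewrite ?nunpair0 ?npairK.
Qed.

Lemma size_encode l : size l <= encode_seq l.
Proof. by elim: l => //= a l; have := npair_ge a (encode_seq l); lia. Qed.

Lemma clen_encode l : clen (encode_seq l) = size l.
Proof.
rewrite /clen /bsum; transitivity (\sum_(i < encode_seq l) (i < size l)).
  apply: eq_bigr => i _; rewrite cdrop_encode -subn_gt0 -size_drop.
  by case: (drop i l).
have := size_encode l; elim: (encode_seq l) (size l) => [|k IHk] d dk.
  by rewrite big_ord0; lia.
rewrite big_ord_recr /=; case: (ltngtP d k.+1) dk => // [dk|->] _.
  by rewrite IHk; lia.
rewrite addn1 -[X in _ = X.+1](IHk k) //; congr S.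
by apply: eq_bigr => i _; rewrite ltnS (ltnW (ltn_ord i)) ltn_ord.
Qed.

Lemma encode_seq_inj : injective encode_seq.
Proof.
by elim=> [|a l IHl] [|b l'] //= [/npair_inj[-> /IHl->]].
Qed.

(** Since every number codes a sequence, validity checks concern only the entries. *)
Lemma encode_seq_surj n : exists l, encode_seq l = n.
Proof.
elim: n {-2}n (leqnn n) => [|N IHN] [|n] // nN; try by exists [::].
have [l lE] := IHN (nunpair n).2 (leq_trans (nunpair_le2 n) nN).
by exists ((nunpair n).1 :: l); rewrite /= lE nunpairK.
Qed.

Lemma rec_cdrop F G : rec F -> rec G -> rec (fun o e => cdrop (F o e) (G o e)).
Proof.
move=> rF rG; rewrite /cdrop.
by apply: (@rec_primrec _ (fun o e _ r => (nunpair r.-1).2)); rec_auto.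
Qed.
#[export] Hint Resolve rec_cdrop : rec.

Lemma rec_cnth F G : rec F -> rec G -> rec (fun o e => cnth (F o e) (G o e)).
Proof. by move=> rF rG; rewrite /cnth; rec_auto. Qed.

Lemma rec_clen F : rec F -> rec (fun o e => clen (F o e)).
Proof.
move=> rF; apply: (@rec_comp (fun o e => clen e)) => //; rewrite /clen.
by rec_auto.
Qed.
#[export] Hint Resolve rec_cnth rec_clen : rec.

Lemma rec_ev (c : Defs.code) S F N : rec S -> rec F -> rec N ->
  rec (fun o e => ev c (cnth (S o e)) (F o e) (N o e)).
Proof.
elim: c S F N => /=; try by move=> *; rec_auto.
- move=> f IHf g IHg S F N rS rF rN.
  apply: (@rec_primrec _ (fun o e k r => if 0 < r then
    ev g (cnth (S o e)) (F o e) (npair (nunpair (N o e)).1 (npair k r.-1)) else 0)).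
  + by apply: IHf; rec_auto.
  + apply: rec_if; [by rec_auto| |exact: rec_const].
    by apply: IHg; [apply: (rec_comp rS)|apply: (rec_comp rF)|
      apply: rec_pair; [apply: rec_fst; apply: (rec_comp rN)|]]; rec_auto.
  + by rec_auto.
- move=> f IHf S F N rS rF rN; apply: rec_pred.
  apply: (@rec_primrec _ (fun o e k r => if r == 1 then
    (if ev f (cnth (S o e)) (F o e) (npair (N o e) k) == 1 then k.+2
     else if ev f (cnth (S o e)) (F o e) (npair (N o e) k) == 0 then 0 else 1)
    else r)); [by rec_auto| |by rec_auto].
  have re : rec (fun o n => ev f (cnth (S o (nunpair n).1)) (F o (nunpair n).1)
    (npair (N o (nunpair n).1) (nunpair (nunpair n).2).1)).
    by apply: IHf; [apply: (rec_comp rS)|apply: (rec_comp rF)|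
      apply: rec_pair; [apply: (rec_comp rN)|]]; rec_auto.
  by rec_auto.
Qed.
#[export] Hint Resolve rec_ev : rec.

(** Every partial computation to be constructed has this form: a decidable relation, a search, and a
    total output function. Different witnesses may give different outputs; the least one makes the
    result unique. *)
Lemma rec_search (Q : (nat -> nat) -> nat -> nat -> bool) out :
  rec (fun o n => nat_of_bool (Q o (nunpair n).1 (nunpair n).2)) -> rec out ->
  exists c, forall o n m, computes o c n m <-> exists w,
    [/\ Q o n w, forall v, v < w -> ~~ Q o n v & m = out o (npair n w)].
Proof.
move=> rQ [d dout]; have [f cf] := rec_not rQ.
exists (CComp d (CPair (CPair CLeft CRight) (CMin f))) => o n m /=.
have fP v r : computes o f (npair n v) r <-> r = ~~ Q o n v.
  have := cf o (npair n v); rewrite npairK /= => fv.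
  by split => [/computes_det/(_ fv) //|->].
split=> [[k [a [b [[a' [b' [-> -> ->]]] [/fP Q0 Qlt] ->]]] dm]|[w [Qw Qlt ->]]].
  exists b; split; first by case: (Q o n b) Q0.
    by move=> v /Qlt[r /fP]; case: (Q o n v).
  by apply: computes_det dm _; rewrite nunpairK; exact: dout.
exists (npair n w); last exact: dout.
exists n, w; split => //; first by exists (nunpair n).1, (nunpair n).2; rewrite nunpairK.
split; first by apply/fP; rewrite Qw.
by move=> v /Qlt Qv; exists 0; apply/fP; rewrite Qv.
Qed.

Lemma comp_enumerable_exists (P : nat -> nat -> bool) :
  rec (fun o n => nat_of_bool (P (nunpair n).1 (nunpair n).2)) ->
  comp_enumerable [set n | exists w, P n w].
Proof.
move=> rP; have [c cP] := @rec_search (fun _ => P) _ rP rec_id.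
exists c => n; split=> [[w Pw]|[m /cP[w [Pw _ _]]]]; last by exists w.
have [v Pv vmin] := ex_minnP (ex_intro (P n) w Pw).
exists (npair n v); apply/cP; exists v; split=> // u uv.
by apply/negP => /vmin; lia.
Qed.

(** Enumerations have the oracle that is constantly 0, and so is [cnth 0], the reading of the empty
    sequence. Membership becomes a decidable condition on the fuel. *)
Lemma comp_enumerableP (S : set nat) : comp_enumerable S ->
  exists c, forall n, S n <-> exists fuel, 0 < ev c (cnth 0) fuel n.
Proof.
move=> [c cS]; exists c => n; rewrite cS.
have z0 i : cnth 0 i = 0 by rewrite (cnth_encode [::]) nth_nil.
split=> [[m /ev_complete[N H]]|[fuel]].
  by exists N; rewrite (H N).
case E: (ev _ _ _ _) => [//|m] _; exists m.
by apply: ev_sound E => i _; rewrite z0.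
Qed.

(** * The Prokhorov distance on a discrete space *)

Local Open Scope ring_scope.

Section Prokhorov.
Variables (R : realType) (Sigma : finType).
Local Notation W := (word Sigma).
Local Notation M := (probability W R).
Implicit Types (mu nu rho : M) (A : set W).

Definition pr mu A : R := fine (mu A).

Lemma prE mu A : mu A = (pr mu A)%:E.
Proof. by rewrite /pr fineK // fin_num_measure. Qed.

Lemma pr_ge0 mu A : 0 <= pr mu A.
Proof. by rewrite -lee_fin -prE. Qed.

Lemma pr_le1 mu A : pr mu A <= 1.
Proof. by rewrite -lee_fin -prE probability_le1. Qed.

Lemma pr_setC mu A : pr mu (~` A) = 1 - pr mu A.
Proof. by apply: EFin_inj; rewrite -prE probability_setC // prE. Qed.

Lemma pr_subset mu A B : A `<=` B -> pr mu A <= pr mu B.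
Proof. by move=> AB; rewrite -lee_fin -!prE le_measure ?inE. Qed.

Lemma pr_seq mu A (U : seq W) : uniq U ->
  \sum_(y <- U | y \in A) pr mu [set y] = pr mu (A `&` [set` U]).
Proof.
elim: U => [_|a U IHU /= /andP[aU uU]].
  by rewrite big_nil set_nil setI0; apply: EFin_inj; rewrite -prE measure0.
rewrite big_cons IHU //; case: ifPn => [aA|aA].
  apply: EFin_inj; rewrite EFinD -!prE -measureU //; last first.
    by rewrite -subset0 => y [-> [_]]; rewrite /= (negbTE aU).
  congr (mu _); apply/seteqP; split=> y.
    by case=> [->|[Ay Uy]]; split; rewrite /= ?inE ?eqxx ?Uy ?orbT //; exact/set_mem.
  by case=> Ay; rewrite /= inE => /predU1P[->|Uy]; [left | right].
congr pr; apply/seteqP; split=> y [Ay Uy]; split=> //.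
  by rewrite /= inE Uy orbT.
move: Uy; rewrite /= inE => /predU1P[ya|//].
by move: aA; rewrite -ya mem_set.
Qed.

Lemma prokhorov_nonempty mu nu : [set e : R | 0 < e /\ forall A : set W,
    measurable A -> (mu A <= nu (fattening e A) + e%:E)%E /\
    (nu A <= mu (fattening e A) + e%:E)%E] !=set0.
Proof.
exists 2; split=> // B _; rewrite !prE; split; rewrite -EFinD lee_fin.
  by have := pr_le1 mu B; have := pr_ge0 nu (fattening (2 : R) B); lra.
by have := pr_le1 nu B; have := pr_ge0 mu (fattening (2 : R) B); lra.
Qed.

(** In the discrete metric a fattening by at most 1 adds nothing to a set, and for larger radii the
    inequalities are trivial; the distance is therefore the total variation. One direction suffices,
    as complements give the other. *)
Lemma prokhorov_leP mu nu (e : R) : 0 <= e ->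
  (prokhorov mu nu <= e) <-> (forall A, pr mu A <= pr nu A + e).
Proof.
move=> e0; rewrite /prokhorov; set S := [set _ | _]; split=> [Se A|H].
  apply/ler_addgt0Pr => d d0.
  have /inf_lt : inf S < e + d by rewrite (le_lt_trans Se) // ltrDl.
  case=> [|d' [d'0 /(_ A) []] //].
    exact: prokhorov_nonempty.
  rewrite !prE -EFinD lee_fin => muA _ d'e.
  case: (leP d' 1) => d'1; last first.
    by have := pr_le1 mu A; have := pr_ge0 nu A; lra.
  suff : fattening d' A `<=` A by move=> /(pr_subset nu); lra.
  move=> y [x Ax]; rewrite /word_dist; have [<- //|_] := eqVneq x y.
  by rewrite ltNge d'1.
have H' A : pr nu A <= pr mu A + e.
  by have := H (~` A); rewrite !pr_setC; lra.
apply/ler_addgt0Pr => d d0; apply: inf_lbound; first by exists 0 => x [/ltW].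
split; first lra.
move=> A _; have sub : A `<=` fattening (e + d) A.
  by move=> x Ax; exists x => //; rewrite /word_dist eqxx ltr_wpDl.
rewrite !prE -!EFinD !lee_fin.
have := pr_subset mu sub; have := pr_subset nu sub; have := H A; have := H' A.
by split; lra.
Qed.

Lemma prokhorov_ge0 mu nu : 0 <= prokhorov mu nu.
Proof. by apply: lb_le_inf; [exact: prokhorov_nonempty | move=> x [/ltW]]. Qed.

Lemma pr_prokhorov mu nu A : pr mu A <= pr nu A + prokhorov mu nu.
Proof. by move: A; apply/(prokhorov_leP _ _ (prokhorov_ge0 _ _)). Qed.

Lemma prokhorovC mu nu : prokhorov mu nu = prokhorov nu mu.
Proof.
wlog suff H : mu nu / prokhorov mu nu <= prokhorov nu mu.
  by apply/eqP; rewrite eq_le !H.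
apply/prokhorov_leP => [|A]; first exact: prokhorov_ge0.
by have := pr_prokhorov nu mu (~` A); rewrite !pr_setC; lra.
Qed.

Lemma prokhorov_triangle nu mu rho :
  prokhorov mu rho <= prokhorov mu nu + prokhorov nu rho.
Proof.
apply/prokhorov_leP => [|A]; first by rewrite addr_ge0 ?prokhorov_ge0.
by have := pr_prokhorov mu nu A; have := pr_prokhorov nu rho A; lra.
Qed.

(** The supremum of mu(A) - nu(A) is attained at the set of points of [U] where mu exceeds nu. Only
    one of the two measures needs finite support. *)
Lemma prokhorov_finite_support mu nu (U : seq W) : uniq U -> pr mu [set` U] = 1 ->
  prokhorov mu nu = \sum_(y <- U) Num.max 0 (pr mu [set y] - pr nu [set y]).
Proof.
move=> uU muU; apply/eqP; rewrite eq_le; apply/andP; split.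
  apply/prokhorov_leP => [|A].
    by apply: sumr_ge0 => y _; rewrite le_max lexx.
  have muA : pr mu A = \sum_(y <- U | y \in A) pr mu [set y].
    rewrite pr_seq //; apply/eqP; rewrite eq_le andbC pr_subset ?subIsetl //=.
    have sub : ~` (A `&` [set` U]) `<=` ~` A `|` ~` [set` U] by rewrite setCI.
    have : (mu (~` (A `&` [set` U])) <= mu (~` A) + mu (~` [set` U]))%E.
      by rewrite (le_trans (le_measure mu _ _ sub)) ?inE // measureU2.
    by rewrite !prE -EFinD lee_fin !pr_setC muU; lra.
  have nuA : \sum_(y <- U | y \in A) pr nu [set y] <= pr nu A.
    by rewrite pr_seq // pr_subset //; exact: subIsetl.
  rewrite muA -lerBlDl; apply: (le_trans (lerB (lexx _) nuA)).
  rewrite -sumrB [leRHS](bigID (mem A)) /=.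
  apply: ler_wpDr.
    by apply: sumr_ge0 => y _; rewrite le_max lexx.
  by apply: ler_sum => y _; rewrite le_max lexx orbT.
pose A := [set y | pr nu [set y] < pr mu [set y]] `&` [set` U].
rewrite (bigID (mem A)) /= [X in _ + X]big1_seq ?addr0; last first.
  move=> y /andP[yA yU]; apply/max_idPl; rewrite subr_le0 leNgt.
  by apply: contra yA => lt; rewrite mem_set.
have := pr_prokhorov mu nu (A `&` [set` U]); rewrite -!pr_seq // => le.
rewrite (eq_bigr (fun y => pr mu [set y] - pr nu [set y])) ?sumrB; first by lra.
by move=> y /set_mem[/= lt _]; apply/max_idPr; rewrite subr_ge0 ltW.
Qed.

End Prokhorov.

(** * Arithmetic on codes of ideal measures *)

Local Open Scope nat_scope.

Section Codes.
Variable (Sigma : finType).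
Local Notation W := (word Sigma).

(** Positions past the end read 0, which is not the number of a letter when [Sigma] is empty; hence
    the first disjunct. *)
Definition cvalid_word (w : nat) : bool :=
  ball_all w (fun i => (cdrop w i == 0) || (cnth w i < #|Sigma|)).

Definition cvalid_ideal (s : nat) : bool :=
  ball_all s (fun i => cvalid_word (nunpair (cnth s i)).1).

Lemma encode_word_inj : injective (@encode_word Sigma).
Proof.
by move=> x y /encode_seq_inj/inj_map; apply => a b /ord_inj/enum_rank_inj.
Qed.

Lemma cvalid_encode_word (x : W) : cvalid_word (encode_word x).
Proof.
apply/ball_allP => i _; rewrite cdrop_encode cnth_encode.
have [lt|ge] := ltnP i (size x); last by rewrite drop_oversize ?size_map.
have [a0 _] : exists a0 : Sigma, True by case: x lt => [|a ?] // _; exists a.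
by rewrite (nth_map a0) // ltn_ord orbT.
Qed.

Lemma cvalid_wordP w : cvalid_word w -> exists x : W, encode_word x = w.
Proof.
have [l <-] := encode_seq_surj w => /ball_allP H.
have {H} lt i : i < size l -> nth 0 l i < #|Sigma|.
  move=> il; have := H i (leq_trans il (size_encode l)).
  rewrite cdrop_encode cnth_encode (drop_nth 0 il) /=.
  by case: (nth 0 l i < _).
suff [x xl] : exists x : W, [seq nat_of_ord (enum_rank a) | a <- x] = l.
  by exists x; rewrite /encode_word xl.
elim: l lt => [|n l IHl] lt; first by exists [::].
have [|x <-] := IHl; first by move=> i il; exact: (lt i.+1).
have n_lt : n < #|Sigma| := lt 0 isT.
by exists (enum_val (Ordinal n_lt) :: x); rewrite /= enum_valK.
Qed.

Lemma cvalid_encode_ideal (s : seq (W * nat)) : cvalid_ideal (encode_ideal s).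
Proof.
apply/ball_allP => i _; rewrite /encode_ideal cnth_encode.
have [lt|ge] := ltnP i (size s); last first.
  by rewrite nth_default ?size_map // nunpair0; apply/ball_allP.
by rewrite (nth_map ([::], 0)) // npairK cvalid_encode_word.
Qed.

Lemma cvalid_idealP c : cvalid_ideal c -> exists s : seq (W * nat), encode_ideal s = c.
Proof.
have [l <-] := encode_seq_surj c => /ball_allP H.
have {H} v i : i < size l -> cvalid_word (nunpair (nth 0 l i)).1.
  by move=> il; have := H i (leq_trans il (size_encode l)); rewrite cnth_encode.
suff [s sl] : exists s : seq (W * nat),
    [seq npair (encode_word a.1) a.2 | a <- s] = l.
  by exists s; rewrite /encode_ideal sl.
elim: l v => [|n l IHl] v; first by exists [::].
have [|s <-] := IHl; first by move=> i il; exact: (v i.+1).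
have [x xE] := cvalid_wordP (v 0 isT).
by exists ((x, (nunpair n).2) :: s); rewrite /= xE nunpairK.
Qed.

Lemma encode_ideal_inj : injective (@encode_ideal Sigma).
Proof.
move=> s s' /encode_seq_inj/inj_map; apply => -[a n] [b m] /=.
by case/npair_inj => /encode_word_inj -> ->.
Qed.

Lemma rec_cvalid_word F : rec F -> rec (fun o e => nat_of_bool (cvalid_word (F o e))).
Proof.
move=> rF; apply: (@rec_comp (fun o e => nat_of_bool (cvalid_word e))) => //.
rewrite /cvalid_word.
by apply: (@rec_ball (fun o e i => (cdrop e i == 0) || (cnth e i < #|Sigma|)));
  rec_auto.
Qed.

Lemma rec_cvalid_ideal F : rec F -> rec (fun o e => nat_of_bool (cvalid_ideal (F o e))).
Proof.
move=> rF; apply: (@rec_comp (fun o e => nat_of_bool (cvalid_ideal e))) => //.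
apply: (@rec_ball (fun o e i => cvalid_word (nunpair (cnth e i)).1)); rec_auto.
by apply: rec_cvalid_word; rec_auto.
Qed.

End Codes.
#[export] Hint Resolve rec_cvalid_word rec_cvalid_ideal : rec.

(** The sum runs up to the code, which is at least the length; the surplus entries read 0, where [f]
    vanishes. *)
Lemma bsum_encode (l : seq nat) (f : nat -> nat) : f 0 = 0 ->
  bsum (encode_seq l) (fun i => f (cnth (encode_seq l) i)) = \sum_(a <- l) f a.
Proof.
move=> f0; rewrite /bsum (eq_bigr (fun i => f (nth 0 l (nat_of_ord i)))); last first.
  by move=> i _; rewrite cnth_encode.
have := size_encode l; move: (encode_seq l) => N lN.
rewrite -(big_mkord predT (fun i => f (nth 0 l i))) (@big_cat_nat _ _ _ (size l)) //=.
rewrite [RHS](big_nth 0) [X in _ + X]big_nat_cond [X in _ + X]big1 ?addn0 // => i.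
by case/andP => /andP[li _] _; rewrite nth_default.
Qed.

Lemma bsum_seq N (f : nat -> nat) (l : seq nat) : uniq l ->
  {in l, forall i, i < N} -> (forall i, i < N -> i \notin l -> f i = 0) ->
  bsum N f = \sum_(i <- l) f i.
Proof.
move=> ul lN f0; rewrite /bsum -(big_mkord predT) (bigID (mem l)) /=.
rewrite [X in _ + X]big_nat_cond [X in _ + X]big1 ?addn0; last first.
  by move=> i /andP[/andP[_ iN] il]; exact: f0.
rewrite -big_filter; apply/perm_big/uniq_perm; rewrite ?filter_uniq ?iota_uniq //.
move=> i; rewrite mem_filter mem_index_iota /=; case: (boolP (i \in l)) => //=.
exact: lN.
Qed.

Definition ctot (s : nat) : nat := bsum s (fun i => (nunpair (cnth s i)).2).
Definition ccnt (s y : nat) : nat :=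
  bsum s (fun i => ((nunpair (cnth s i)).1 == y) * (nunpair (cnth s i)).2).
(* The measure with code [s] gives to the word with code [y] the probability
   [cweight s y / cden s]. *)
Definition cden (s : nat) : nat := if ctot s == 0 then 1 else ctot s.
Definition cweight (s y : nat) : nat := if ctot s == 0 then nat_of_bool (y == 0) else ccnt s y.
(** Numerator of the sum in [prokhorov_finite_support] over the product of the denominators;
    truncated subtraction is the maximum with 0. The range covers the support of [s], since a word
    in a list has a code at most that of the list. *)
Definition cdist (s s' : nat) : nat :=
  bsum s.+1 (fun y => cweight s y * cden s' - cweight s' y * cden s).

Lemma cden_gt0 s : 0 < cden s.
Proof. by rewrite /cden; case: eqP => //; lia. Qed.

Lemma rec_cden F : rec F -> rec (fun o e => cden (F o e)).
Proof.
move=> rF; apply: (@rec_comp (fun o e => cden e)) => //; rewrite /cden /ctot.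
have r : rec (fun o s => bsum s (fun i => (nunpair (cnth s i)).2)).
  by apply: (@rec_sum (fun o s i => (nunpair (cnth s i)).2)); rec_auto.
by rec_auto.
Qed.

Lemma rec_cweight F G : rec F -> rec G -> rec (fun o e => cweight (F o e) (G o e)).
Proof.
move=> rF rG; have : rec (fun o e => cweight (nunpair e).1 (nunpair e).2).
  rewrite /cweight /ctot /ccnt.
  have r : rec (fun o s => bsum s (fun i => (nunpair (cnth s i)).2)).
    by apply: (@rec_sum (fun o s i => (nunpair (cnth s i)).2)); rec_auto.
  apply: rec_if; [|by rec_auto|].
    by apply: rec_eqn; rec_auto; apply: (rec_comp r); rec_auto.
  by apply: (@rec_sum (fun o e i => ((nunpair (cnth (nunpair e).1 i)).1
    == (nunpair e).2) * (nunpair (cnth (nunpair e).1 i)).2)); rec_auto.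
move=> /rec_comp/(_ (rec_pair rF rG)); apply: rec_ext => o e.
by rewrite npairK.
Qed.
#[export] Hint Resolve rec_cden rec_cweight : rec.

Lemma rec_cdist F G : rec F -> rec G -> rec (fun o e => cdist (F o e) (G o e)).
Proof.
move=> rF rG; have : rec (fun o e => cdist (nunpair e).1 (nunpair e).2).
  rewrite /cdist.
  by apply: (@rec_sum (fun o e y => cweight (nunpair e).1 y * cden (nunpair e).2
    - cweight (nunpair e).2 y * cden (nunpair e).1)); rec_auto.
move=> /rec_comp/(_ (rec_pair rF rG)); apply: rec_ext => o e.
by rewrite npairK.
Qed.
#[export] Hint Resolve rec_cdist : rec.

Section IdealMeasures.
Variables (R : realType) (Sigma : finType).
Local Notation W := (word Sigma).
Local Notation M := (probability W R).
Implicit Types (s : seq (W * nat)).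

Lemma ctotE s : ctot (encode_ideal s) = \sum_(a <- s) a.2.
Proof.
rewrite /ctot (@bsum_encode _ (fun c => (nunpair c).2)) ?nunpair0 // big_map.
by apply: eq_bigr => a _; rewrite npairK.
Qed.

Lemma ccntE s y : ccnt (encode_ideal s) y = \sum_(a <- s | encode_word a.1 == y) a.2.
Proof.
rewrite /ccnt (@bsum_encode _ (fun c => ((nunpair c).1 == y) * (nunpair c).2));
  last by rewrite nunpair0 muln0.
rewrite big_map [RHS]big_mkcond; apply: eq_bigr => a _.
by rewrite npairK; case: eqP => _; rewrite ?mul1n.
Qed.

Local Open Scope ring_scope.

Lemma pr_ideal0 s A : (\sum_(a <- s) a.2 = 0)%N ->
  pr (ideal_measure R s) A = \1_A [::].
Proof.
move=> s0; rewrite /pr /ideal_measure /= /mnormalize /=.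
have E : @msum _ _ R (fun i => mscale (((nth (point, 0%N) s i).2%:R : R)%:nng)
       (dirac (nth (point, 0%N) s i).1)) (size s) setT = 0%E.
  transitivity (\sum_(a <- s) a.2%:R * (\1_setT a.1 : R))%:E.
    rewrite /msum (big_nth (point, 0%N)) big_mkord -sumEFin.
    by apply: eq_bigr => i _; rewrite EFinM /mscale/= /dirac.
  congr EFin; rewrite (eq_bigr (fun a => a.2%:R)) => [|a _].
    by rewrite -natr_sum s0.
  by rewrite indicE in_setT mulr1.
by rewrite E eqxx.
Qed.

Lemma pr_ideal s A : (0 < \sum_(a <- s) a.2)%N -> pr (ideal_measure R s) A =
  (\sum_(a <- s) a.2%:R * \1_A a.1) / (\sum_(a <- s) a.2)%:R.
Proof. by move=> s0; rewrite /pr ideal_measureE. Qed.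

Lemma pr_ideal1 s x : pr (ideal_measure R s) [set x] =
  (cweight (encode_ideal s) (encode_word x))%:R / (cden (encode_ideal s))%:R.
Proof.
rewrite /cweight /cden ctotE ccntE; case: eqP => [s0|/eqP].
  rewrite pr_ideal0 // divr1 indicE classical_sets.in_set1 eq_sym.
  by rewrite -(inj_eq (@encode_word_inj Sigma)).
rewrite -lt0n => s0; rewrite pr_ideal //; congr (_ / _).
rewrite natr_sum [RHS]big_mkcond; apply: eq_bigr => a _.
rewrite indicE classical_sets.in_set1 (inj_eq (@encode_word_inj Sigma)).
by case: eqP; rewrite ?mulr1 ?mulr0.
Qed.

(** The empty word is included for the lists of total weight 0, which denote the Dirac measure
    there. *)
Definition ideal_support s : seq W := undup ([::] :: [seq a.1 | a <- s]).

Lemma pr_ideal_support s : pr (ideal_measure R s) [set` ideal_support s] = 1.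
Proof.
have [s0|s0] := posnP (\sum_(a <- s) a.2).
  by rewrite pr_ideal0 // indicE mem_set //= mem_undup inE eqxx.
rewrite pr_ideal // (eq_big_seq (fun a => a.2%:R)).
  by rewrite -natr_sum divff // pnatr_eq0 -lt0n.
move=> a sa; rewrite indicE mem_set ?mulr1 //= mem_undup inE.
by apply/orP; right; apply: map_f.
Qed.

Lemma encode_ideal_ge s a : a \in s -> (encode_word a.1 <= encode_ideal s)%N.
Proof.
rewrite /encode_ideal; elim: s => //= b s IHs; rewrite inE => /predU1P[->|/IHs le].
  have := npair_ge (npair (encode_word b.1) b.2)
    (encode_seq [seq npair (encode_word a.1) a.2 | a <- s]).
  by have := npair_ge (encode_word b.1) b.2; lia.
have := npair_ge (npair (encode_word b.1) b.2)
    (encode_seq [seq npair (encode_word a.1) a.2 | a <- s]).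
by lia.
Qed.

Lemma prokhorov_ideal s s' :
  prokhorov (ideal_measure R s) (ideal_measure R s') =
  (cdist (encode_ideal s) (encode_ideal s'))%:R /
  (cden (encode_ideal s) * cden (encode_ideal s'))%:R.
Proof.
rewrite (prokhorov_finite_support _ (undup_uniq _) (pr_ideal_support s)).
rewrite /cdist (@bsum_seq _ _ [seq encode_word x | x <- ideal_support s]).
- rewrite big_map natr_sum mulr_suml; apply: eq_bigr => x _.
  rewrite !pr_ideal1; set d := cden _; set d' := cden _; set w := cweight _ _.
  set w' := cweight _ _.
  have d0 : 0 < d%:R :> R by rewrite ltr0n cden_gt0.
  have d'0 : 0 < d'%:R :> R by rewrite ltr0n cden_gt0.
  have -> : w%:R / d%:R - w'%:R / d'%:R = ((w * d')%:R - (w' * d)%:R) / (d * d')%:R :> R.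
    by rewrite !natrM; field; rewrite ?gt_eqF.
  have [le|gt] := leqP (w' * d) (w * d').
    by rewrite natrB //; apply/max_idPr; rewrite divr_ge0 // subr_ge0 ler_nat.
  have -> : (w * d' - w' * d = 0)%N by lia.
  rewrite mul0r; apply/max_idPl; rewrite ler_pdivrMr ?natrM ?mulr_gt0 // mul0r.
  by rewrite subr_le0 -!natrM ler_nat ltnW.
- by rewrite map_inj_uniq ?undup_uniq //; exact: encode_word_inj.
- move=> _ /mapP[x + ->]; rewrite mem_undup inE => /predU1P[->|/mapP[a sa ->]] //.
  by rewrite ltnS; exact: encode_ideal_ge.
move=> i _ iU; suff -> : cweight (encode_ideal s) i = 0%N by rewrite mul0n sub0n.
rewrite /cweight ccntE; case: eqP => _.
  apply/eqP; rewrite eqb0; apply: contra iU => /eqP ->.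
  by apply/mapP; exists [::] => //; rewrite mem_undup inE eqxx.
rewrite big_seq_cond big1 // => a /andP[sa /eqP ai]; case/mapP: iU.
by exists a.1 => //; rewrite mem_undup inE; apply/orP; right; apply: map_f.
Qed.

End IdealMeasures.

(** * Density of the ideal measures; names *)

Local Open Scope ring_scope.

Section Names.
Variables (R : realType) (Sigma : finType).
Local Notation W := (word Sigma).
Local Notation M := (probability W R).
Implicit Types (mu : M).

Lemma exp2V_small (e : R) : 0 < e -> exists n, forall m, (n <= m)%N -> 2^-1 ^+ m < e.
Proof.
move=> e0; exists (Num.truncn e^-1).+1 => m nm.
have /truncn_itv/andP[_ lt] : 0 <= e^-1 by rewrite invr_ge0 ltW.
rewrite exprVn invf_plt ?posrE ?exprn_gt0 //; apply: (lt_le_trans lt).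
by rewrite -natrX ler_nat (leq_trans nm) // ltnW // ltn_expl.
Qed.

Lemma words_below (n : nat) :
  exists U : seq W, uniq U /\ forall x, (x \in U) = (encode_word x < n)%N.
Proof.
elim: n => [|n [U [uU UE]]]; first by exists [::].
have [[x xn]|nx] := pselect (exists x : W, encode_word x = n).
  exists (x :: U); split=> [|y]; first by rewrite /= uU UE xn ltnn.
  rewrite inE UE ltnS [RHS]leq_eqVlt; congr orb.
  by rewrite -xn (inj_eq (@encode_word_inj Sigma)).
exists U; split=> // y; rewrite UE ltnS [RHS]leq_eqVlt.
by case: eqP => // yn; case: nx; exists y.
Qed.

Lemma finite_mass mu (e : R) : 0 < e ->
  exists2 U : seq W, uniq U & 1 - e < pr mu [set` U].
Proof.
move=> e0; pose F (n : nat) := [set x : W | (encode_word x < n)%N].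
have FT : \bigcup_n F n = setT.
  by apply/seteqP; split=> // x _; exists (encode_word x).+1 => //=; rewrite /F /=.
have /fine_cvg/cvgr_gt H : (mu \o F) n @[n --> \oo] --> 1%:E.
  rewrite -(@probability_setT _ _ _ mu) -FT; apply: nondecreasing_cvg_mu => //.
  by move=> m n mn; apply/subsetPset => x /= lt; exact: leq_trans lt mn.
have [n _ /(_ n (leqnn n)) lt] := H (1 - e) ltac:(lra).
have [U [uU UE]] := words_below n; exists U => //.
rewrite (_ : [set` U] = F n) //; apply/seteqP.
by split=> x /=; rewrite UE.
Qed.

(** Probabilities on a finite set [U] of large mass are rounded down to multiples of 1/N, and the
    remaining weight goes to the empty word. It suffices to bound what a set loses: the tail outside
    [U] and one rounding error per word of [U]. *)
Lemma ideal_dense mu (e : R) : 0 < e ->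
  exists s, prokhorov (ideal_measure R s) mu < e.
Proof.
move=> e0; have [U uU muU] := @finite_mass mu (e / 4) ltac:(lra).
(* With this denominator the [size U] rounding errors of at most 1/N add up to at most e/4. *)
pose N := (Num.truncn ((size U)%:R / (e / 4))).+1.
pose k (y : W) := Num.truncn (N%:R * pr mu [set y]).
have N0 : 0 < N%:R :> R by rewrite ltr0n.
have kP y : (k y)%:R <= N%:R * pr mu [set y] < (k y).+1%:R.
  by apply: truncn_itv; rewrite mulr_ge0 ?pr_ge0 // ltW.
have kN : (\sum_(y <- U) k y <= N)%N.
  rewrite -(ler_nat R) natr_sum; apply: (@le_trans _ _ (\sum_(y <- U) N%:R * pr mu [set y])).
    by apply: ler_sum => y _; have /andP[] := kP y.
  rewrite -mulr_sumr ler_piMr ?(ltW N0) //.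
  have := pr_seq mu setT uU; rewrite (eq_bigl predT) => [->|y]; last by rewrite in_setT.
  exact: pr_le1.
pose s := ([::], N - \sum_(y <- U) k y)%N :: [seq (y, k y) | y <- U].
have sN : (\sum_(a <- s) a.2 = N)%N by rewrite big_cons big_map /= subnK.
exists s; apply: (@le_lt_trans _ _ (e / 2)); last lra.
rewrite prokhorovC; apply/prokhorov_leP => [|A]; first by lra.
rewrite pr_ideal ?sN // big_cons big_map /=.
have UN : (size U)%:R / N%:R <= e / 4.
  have /truncn_itv/andP[_] : 0 <= (size U)%:R / (e / 4).
    by rewrite divr_ge0 //; lra.
  by rewrite -/N ltr_pdivrMr ?ler_pdivrMr; lra.
have muA : pr mu A <= pr mu (A `&` [set` U]) + (1 - pr mu [set` U]).
  have sub : A `<=` (A `&` [set` U]) `|` ~` [set` U].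
    by move=> x Ax; have [Ux|Ux] := boolP (x \in U); [left | right; exact/negP].
  have : (mu A <= mu (A `&` [set` U]) + mu (~` [set` U]))%E.
    by rewrite (le_trans (le_measure mu _ _ sub)) ?inE // measureU2.
  by rewrite !prE -EFinD lee_fin pr_setC.
have : pr mu (A `&` [set` U]) <=
    (\sum_(y <- U) (k y)%:R * \1_A y) / N%:R + (size U)%:R / N%:R.
  rewrite -mulrDl ler_pdivlMr // -pr_seq // mulr_suml big_mkcond /=.
  rewrite -sum1_size natr_sum -big_split; apply: ler_sum => y _ /=.
  rewrite indicE; case: (y \in A); rewrite ?mulr1 ?mulr0 ?add0r //.
  by have /andP[_ /ltW] := kP y; rewrite mulrC -natr1.
have : 0 <= (N - \sum_(y <- U) k y)%:R * \1_A ([::] : W) / N%:R :> R.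
  by rewrite divr_ge0 // mulr_ge0.
by rewrite mulrDl; lra.
Qed.

Lemma ideal_sequence mu (k : nat -> nat) :
  exists s, forall i, prokhorov (ideal_measure R (s i)) mu < 2^-1 ^+ k i.
Proof.
have e0 i : 0 < 2^-1 ^+ k i :> R by rewrite exprn_gt0 // invr_gt0.
by have [s sP] := choice (fun i => ideal_dense mu (e0 i)); exists s.
Qed.

Lemma name_dist (z : nat -> nat) mu : name z mu ->
  exists s, (forall i, z i = encode_ideal (s i)) /\
    forall i, prokhorov (ideal_measure R (s i)) mu <= 2^-1 ^+ i.
Proof.
move=> [s [zs cs ls]]; exists s; split=> // i; apply/ler_addgt0Pr => e e0.
have [n _ H] := (iffLR (@cvgrPdist_lt _ R _ _ _ _ _)) ls e e0.
have := H (maxn i n) (leq_maxr _ _); rewrite /= sub0r normrN ger0_norm ?prokhorov_ge0 // => lt.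
have := prokhorov_triangle (ideal_measure R (s (maxn i n))) (ideal_measure R (s i)) mu.
by have := cs i (maxn i n) (leq_maxl _ _); lra.
Qed.

(** The exponent [i.+1] makes the entries [i <= j] lie within 2^-(i+1) + 2^-(j+1) <= 2^-i of each
    other. *)
Lemma name_intro mu (s : nat -> seq (W * nat)) :
  (forall i, prokhorov (ideal_measure R (s i)) mu <= 2^-1 ^+ i.+1) ->
  name (fun i => encode_ideal (s i)) mu.
Proof.
move=> H; exists s; split=> // [i j ij|].
  have := prokhorov_triangle mu (ideal_measure R (s i)) (ideal_measure R (s j)).
  rewrite (prokhorovC mu); have := H i; have := H j.
  have : 2^-1 ^+ j <= 2^-1 ^+ i :> R by rewrite ler_wiXn2l //; lra.
  by rewrite !exprS; lra.
apply/cvgrPdist_lt => e e0; have [n nP] := exp2V_small e0.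
exists n => // m /= nm; rewrite sub0r normrN ger0_norm ?prokhorov_ge0 //.
by apply: le_lt_trans (H m) (nP _ _); rewrite ltnW.
Qed.

End Names.

(** * Interpreters *)

Section Interpreters.
Variables (R : realType) (Sigma : finType).
Local Notation W := (word Sigma).
Local Notation M := (probability W R).
Implicit Types (mu : M) (A : seq bool -> M -> option W).

Definition rel_interpreter (P : seq bool -> M -> W -> Prop) (p : seq bool) mu : option W :=
  if pselect (exists x, P p mu x) is left e then Some (sval (cid e)) else None.

Lemma rel_interpreterP (P : seq bool -> M -> W -> Prop) p mu x :
  (forall y z, P p mu y -> P p mu z -> y = z) ->
  rel_interpreter P p mu = Some x <-> P p mu x.
Proof.
move=> Pfun; rewrite /rel_interpreter; case: pselect => [e|ne]; last first.
  by split=> // Px; case: ne; exists x.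
case: (cid e) => y Py /=; split=> [[<-] //|Px].
by rewrite (Pfun _ _ Py Px).
Qed.

Lemma rel_interpreter_defined (P : seq bool -> M -> W -> Prop) p mu :
  rel_interpreter P p mu -> exists x, P p mu x.
Proof. by rewrite /rel_interpreter; case: pselect. Qed.

(* [Q] is the relation that is searched for a witness and [out] reads the
   result off the witness. *)
Lemma interpreter_search A (Q : (nat -> nat) -> nat -> nat -> bool) out :
  rec (fun o n => nat_of_bool (Q o (nunpair n).1 (nunpair n).2)) -> rec out ->
  (forall mu z, name z mu -> forall p w, Q z (encode_prog p) w ->
    exists2 x, A p mu = Some x & out z (npair (encode_prog p) w) = encode_word x) ->
  (forall mu z, name z mu -> forall p x, A p mu = Some x ->
    exists w, Q z (encode_prog p) w) ->
  (forall mu p1 p2, A p1 mu -> A p2 mu -> prefix p1 p2 -> p1 = p2) ->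
  interpreter A.
Proof.
move=> rQ rout sound complete pfree; split; last first.
  by move=> mu p1 p2 A1 A2 ne; apply/negP => /(pfree _ _ _ A1 A2).
have [c cP] := rec_search rQ rout; exists c => mu z nz p m.
rewrite cP; split=> [[w [/(sound _ _ nz)[x Ax xE] _ ->]]|[x Ax ->]].
  by exists x.
have [w Qw] := complete _ _ nz _ _ Ax.
have [v Qv vmin] := ex_minnP (ex_intro (Q z (encode_prog p)) w Qw).
exists v; split=> // [u uv|]; first by apply/negP => /vmin; lia.
by have [y Ay ->] := sound _ _ nz _ _ Qv; move: Ay; rewrite Ax => -[->].
Qed.

Lemma complexity_le A p x mu : A p mu = Some x ->
  (complexity A x mu <= (size p)%:R%:E)%E.
Proof. by move=> Ap; apply: ereal_inf_lbound; exists p. Qed.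

Lemma complexity_attained A p x mu : A p mu = Some x ->
  exists p0, [/\ A p0 mu = Some x, complexity A x mu = (size p0)%:R%:E &
    forall q, A q mu = Some x -> (size p0 <= size q)%N].
Proof.
move=> Ap; pose P n := `[< exists2 q, A q mu = Some x & size q = n >].
have [|_ /asboolP[p0 Ap0 <-] p0min] := @ex_minnP P.
  by exists (size p); apply/asboolP; exists p.
have {}p0min q : A q mu = Some x -> (size p0 <= size q)%N.
  by move=> Aq; apply: p0min; apply/asboolP; exists q.
exists p0; split=> //; apply/eqP; rewrite eq_le complexity_le //=.
by apply: le_ereal_inf_tmp => _ [q Aq <-]; rewrite lee_fin ler_nat p0min.
Qed.

Definition unary (n : nat) : seq bool := nseq n true ++ [:: false].

Definition cunary (n : nat) : nat :=
  primrec (npair 0 0).+1 (fun _ r => (npair 1 r).+1) n.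

Lemma encode_unary n : encode_prog (unary n) = cunary n.
Proof. by elim: n => // n IHn; rewrite /cunary [RHS]/= -/(cunary n) -IHn. Qed.

Lemma encode_prog_inj : injective encode_prog.
Proof. by move=> p q /encode_seq_inj/inj_map; apply; case; case. Qed.

Lemma unary_inj : injective unary.
Proof. by move=> m n /(congr1 size); rewrite !size_cat !size_nseq /= !addn1 => -[]. Qed.

Lemma unary_prefix m n : prefix (unary m) (unary n) -> m = n.
Proof.
by elim: m n => [|m IHm] [|n] //= /IHm ->.
Qed.

(** Comparison with this interpreter, which ignores the measure, makes the complexity for an optimal
    one finite everywhere, so that shortest programs exist. *)
Lemma unary_interpreter :
  interpreter (rel_interpreter (fun p mu x => p = unary (encode_word x))).
Proof.
have func p (mu : M) (x y : W) : p = unary (encode_word x) -> p = unary (encode_word y) -> x = y.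
  by move=> -> /unary_inj/encode_word_inj.
apply: (@interpreter_search _ (fun o n w => (n == cunary w) && cvalid_word Sigma w)
  (fun o n => (nunpair n).2)).
- have rc : rec (fun o n => cunary n).
    by apply: (@rec_primrec _ (fun o e _ r => (npair 1 r).+1)); rec_auto.
  by apply: rec_and; rec_auto; apply: rec_eqn; [|apply: (rec_comp rc)]; rec_auto.
- by rec_auto.
- move=> mu z _ p w /andP[/eqP + /cvalid_wordP[x xw]].
  rewrite -encode_unary => /encode_prog_inj pw; exists x; last by rewrite npairK.
  by apply/rel_interpreterP; [exact: func | rewrite xw].
- move=> mu z _ p x /rel_interpreterP -> //; last exact: func.
  by exists (encode_word x); rewrite encode_unary eqxx cvalid_encode_word.
- move=> mu p1 p2 /rel_interpreter_defined[x p1E] /rel_interpreter_defined[y p2E].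
  by rewrite p1E p2E => /unary_prefix ->.
Qed.

Lemma optimal_interpreter_total T x mu : optimal_interpreter T ->
  exists p, T p mu = Some x.
Proof.
move=> [_ /(_ _ unary_interpreter)[c /(_ mu x) Hc]].
apply: contrapT => nT; move: Hc.
have -> : complexity T x mu = +oo%E.
  rewrite /complexity [X in ereal_inf X](_ : _ = set0) ?ereal_inf0 //.
  by apply/seteqP; split=> // r [p Tp _]; case: nT; exists p.
have Ax : rel_interpreter (fun p (_ : M) x => p = unary (encode_word x))
    (unary (encode_word x)) mu = Some x.
  by apply/rel_interpreterP => // y z /= -> /unary_inj/encode_word_inj.
have [p0 [_ -> _]] := complexity_attained Ax.
by rewrite -EFinD leye_eq.
Qed.

End Interpreters.

(** * Kraft's inequality and the test 2^-H(x|mu) / mu(x) *)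

Lemma esum_le_seq (R : realType) (T : choiceType) (a : T -> \bar R) c :
  (forall U : seq T, uniq U -> (\sum_(x <- U) a x <= c)%E) ->
  (\esum_(x in [set: T]) a x <= c)%E.
Proof.
move=> H; apply: ge_ereal_sup => _ [A [fA _] <-].
by rewrite fsbig_finite // H // fset_uniq.
Qed.

Lemma seq_le_esum (R : realType) (T : choiceType) (a : T -> \bar R) (U : seq T) :
  uniq U -> (\sum_(x <- U) a x <= \esum_(x in [set: T]) a x)%E.
Proof.
move=> uU; apply: esum_ge; exists [set` U]; first by split=> //; exact: finite_seq.
by rewrite fsbig_seq.
Qed.

(** Induction on a bound for the lengths. If the empty program occurs it is alone; otherwise
    removing the first bit splits the set into two prefix-free sets, each of which contributes at
    most 1/2. *)
Lemma kraft (R : realFieldType) (s : seq (seq bool)) : uniq s ->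
  {in s &, forall p q, prefix p q -> p = q} ->
  \sum_(p <- s) 2^-1 ^+ size p <= 1 :> R.
Proof.
have nil_case (t : seq (seq bool)) : uniq t ->
    {in t &, forall p q, prefix p q -> p = q} -> [::] \in t ->
    \sum_(p <- t) 2^-1 ^+ size p <= 1 :> R.
  move=> ut pf e0; have sub : {subset t <= [:: [::]]}.
    by move=> q qt; rewrite inE -(pf [::] q) //; case: q {qt}.
  have := uniq_leq_size ut sub; case: t e0 {ut pf sub} => [|q [|]] //=.
  by rewrite inE big_seq1 => /eqP <-.
have [N] : exists N, {in s, forall p, (size p <= N)%N}.
  exists (\sum_(p <- s) size p)%N => p ps.
  by rewrite (big_rem p) //= leq_addr.
elim: N s => [|N IHN] s sN us pf.
  case: s sN us pf => [|p s] sN us pf; first by rewrite big_nil.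
  apply: nil_case => //; have := sN p (mem_head _ _).
  by case: p {us pf sN} => // _; rewrite mem_head.
have [e0|ne0] := boolP ([::] \in s); first exact: nil_case.
pose sub b := [seq behead p | p <- s & ohead p == Some b].
have subP b q : (q \in sub b) = (b :: q \in s).
  apply/mapP/idP => [[[|b' q']]|bq]; rewrite ?mem_filter //=.
    by case/andP=> /eqP[->] q's ->.
  by exists (b :: q); rewrite ?mem_filter /= ?eqxx.
have half b : \sum_(p <- s | ohead p == Some b) 2^-1 ^+ size p <= 2^-1 :> R.
  have -> : \sum_(p <- s | ohead p == Some b) 2^-1 ^+ size p =
      2^-1 * \sum_(q <- sub b) 2^-1 ^+ size q :> R.
    rewrite big_map big_filter mulr_sumr; apply: eq_bigr.
    by case=> // b' q _; rewrite exprS.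
  rewrite ler_piMr ?invr_ge0 //; apply: IHN.
  - by move=> q; rewrite subP => /sN.
  - rewrite map_inj_in_uniq ?filter_uniq // => p q.
    rewrite !mem_filter => /andP[+ _] /andP[+ _].
    by case: p q => [|b1 p] [|b2 q] //= /eqP[->] /eqP[->] ->.
  - move=> p q; rewrite !subP => ps qs pq.
    by have := pf _ _ ps qs; rewrite /= eqxx => /(_ pq) [].
rewrite (bigID (fun p => ohead p == Some true)) /=.
rewrite [X in _ + X](_ : _ = \sum_(p <- s | ohead p == Some false) 2^-1 ^+ size p).
  by have := half true; have := half false; lra.
rewrite [LHS]big_seq_cond [RHS]big_seq_cond; apply: eq_bigl => -[|[] p] //=.
by rewrite (negbTE ne0).
Qed.

Lemma ratioD_le_exp2V (R : realFieldType) (a d q1 q2 k : nat) : (0 < d)%N ->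
  (a%:R / d%:R + q1%:R / q2.+1%:R <= 2^-1 ^+ k :> R) =
  ((a * q2.+1 + q1 * d) * 2 ^ k <= d * q2.+1)%N.
Proof.
move=> d0; rewrite addf_div ?pnatr_eq0 // -?lt0n // exprVn.
by rewrite ler_pdivrMr ?mulr_gt0 ?ltr0n // [leRHS]mulrC ler_pdivlMr ?exprn_gt0 //
  -!natrX -!natrM -natrD -!natrM ler_nat.
Qed.

Lemma ratioM_lt_exp2V (R : realFieldType) (r1 r2 a d q1 q2 k : nat) : (0 < d)%N ->
  (r1%:R / r2.+1%:R * (a%:R / d%:R + q1%:R / q2.+1%:R) < 2^-1 ^+ k :> R) =
  (r1 * (a * q2.+1 + q1 * d) * 2 ^ k < r2.+1 * (d * q2.+1))%N.
Proof.
move=> d0; rewrite addf_div ?pnatr_eq0 // -?lt0n // mulf_div exprVn.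
by rewrite ltr_pdivrMr ?mulr_gt0 ?ltr0n // [ltRHS]mulrC ltr_pdivlMr ?exprn_gt0 //
  -!natrX -!natrM -natrD -!natrM ltr_nat.
Qed.

Definition cvalid_prog (p : nat) : bool := ball_all p (fun i => cnth p i < 2)%N.

Lemma cvalid_encode_prog p : cvalid_prog (encode_prog p).
Proof.
apply/ball_allP => i _; rewrite cnth_encode.
have [lt|ge] := ltnP i (size p); last by rewrite nth_default ?size_map.
by rewrite (nth_map false) //; case: nth.
Qed.

Lemma cvalid_progP c : cvalid_prog c -> exists p, encode_prog p = c.
Proof.
have [l <-] := encode_seq_surj c => /ball_allP H.
have {H} v i : (i < size l -> nth 0 l i < 2)%N.
  by move=> il; have := H i (leq_trans il (size_encode l)); rewrite cnth_encode.
suff [p pl] : exists p : seq bool, [seq nat_of_bool b | b <- p] = l.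
  by exists p; rewrite /encode_prog pl.
elim: l v => [|n l IHl] v; first by exists [::].
have [|p <-] := IHl; first by move=> i il; exact: (v i.+1).
exists ((n == 1)%N :: p) => /=; congr cons.
by have := v 0%N isT; case: n {v} => [|[|]].
Qed.

Lemma rec_cvalid_prog F : rec F -> rec (fun o e => nat_of_bool (cvalid_prog (F o e))).
Proof.
move=> rF; apply: (@rec_comp (fun o e => nat_of_bool (cvalid_prog e))) => //.
by apply: (@rec_ball (fun o e i => cnth e i < 2)%N); rec_auto.
Qed.
#[export] Hint Resolve rec_cvalid_prog : rec.

(** * The lower bound: a test built from shortest programs *)

Section KraftTest.
Variables (R : realType) (Sigma : finType).
Local Notation W := (word Sigma).
Local Notation M := (probability W R).
Variable T : seq bool -> M -> option W.
Hypothesis T_optimal : optimal_interpreter T.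

Lemma shortest_program_ex : exists P : M * W -> seq bool, forall a,
  [/\ T (P a) a.1 = Some a.2, complexity T a.2 a.1 = (size (P a))%:R%:E &
    forall q, T q a.1 = Some a.2 -> (size (P a) <= size q)%N].
Proof.
pose Q (a : M * W) (p : seq bool) := [/\ T p a.1 = Some a.2,
  complexity T a.2 a.1 = (size p)%:R%:E &
  forall q, T q a.1 = Some a.2 -> (size p <= size q)%N].
have [|P PQ] := @choice _ _ Q; last by exists P.
move=> -[mu x]; have [p /complexity_attained] := optimal_interpreter_total x mu T_optimal.
exact.
Qed.

Variable P : M * W -> seq bool.
Hypothesis PT : forall a, T (P a) a.1 = Some a.2.
Hypothesis Pmin : forall a q, T q a.1 = Some a.2 -> (size (P a) <= size q)%N.

(** The value [+oo] at probability 0 costs nothing in the mean, where 0 * +oo is 0, and it forces a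
    universal test to be infinite there. *)
Definition kraft_test (mu : M) (x : W) : \bar R :=
  if pr mu [set x] == 0 then +oo%E
  else (2^-1 ^+ size (P (mu, x)) / pr mu [set x])%:E.

Lemma kraft_test_ge0 (mu : M) (x : W) : (0 <= kraft_test mu x)%E.
Proof.
rewrite /kraft_test; case: ifP => _; first exact: leey.
by rewrite lee_fin divr_ge0 ?pr_ge0 // exprn_ge0 // invr_ge0.
Qed.

Lemma kraft_test_sum (mu : M) : (\esum_(x in [set: W]) (mu [set x] * kraft_test mu x) <= 1)%E.
Proof.
apply: esum_le_seq => U uU.
apply: (@le_trans _ _ (\sum_(x <- U) (2^-1 ^+ size (P (mu, x)))%:E)%E).
  apply: lee_sum => x _; rewrite prE /kraft_test; case: eqP => [->|/eqP n0].
    by rewrite mul0e lee_fin exprn_ge0 // invr_ge0.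
  by rewrite -EFinM lee_fin mulrCA divff // mulr1.
rewrite sumEFin lee_fin -(big_map (fun x => P (mu, x)) predT (fun p => 2^-1 ^+ size p)).
have TP z : T (P (mu, z)) mu = Some z := PT (mu, z).
apply: kraft.
  rewrite map_inj_uniq // => x y Pxy; apply: Some_inj.
  by rewrite -(TP x) -(TP y) Pxy.
move=> _ _ /mapP[x _ ->] /mapP[y _ ->]; apply: contraPP => ne.
by have [[_ pf] _] := T_optimal; apply/negP/(pf mu) => //; rewrite TP.
Qed.

(** Multiplying by the probability absorbs the exceptional case, and any program may replace the
    shortest one, since longer programs give weaker bounds. What remains is a halting condition,
    which is enumerable, whereas minimality is not. *)
Lemma kraft_test_gt (mu : M) (x : W) (r : nat * nat) :
  ((nnrat R r)%:E < kraft_test mu x)%E <->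
  exists2 p, T p mu = Some x & nnrat R r * pr mu [set x] < 2^-1 ^+ size p.
Proof.
rewrite /kraft_test; case: eqP => [->|/eqP n0].
  rewrite ltry mulr0; split=> // _; exists (P (mu, x)); first exact: (PT (mu, x)).
  by rewrite exprn_gt0 // invr_gt0.
have m0 : 0 < pr mu [set x] by rewrite lt_def n0 pr_ge0.
rewrite lte_fin ltr_pdivlMr //; split=> [lt|[p Tp lt]].
  by exists (P (mu, x)) => //; exact: (PT (mu, x)).
apply: (lt_le_trans lt); apply: ler_wiXn2l; [lra|lra|].
exact: (@Pmin (mu, x)).
Qed.

(* [n] encodes [x; r1; r2; s; q1; q2] as in [lower_semicomputable], and the
   witness consists of finitely many entries of a name, fuel, and a program. *)
Definition kraft_ball (B : Defs.code) (n w : nat) : bool :=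
  let x := cnth n 0 in let r1 := cnth n 1 in let r2 := cnth n 2 in
  let s := cnth n 3 in let q1 := cnth n 4 in let q2 := cnth n 5 in
  let z := cnth (nunpair w).1 in
  let fuel := (nunpair (nunpair w).2).1 in let p := (nunpair (nunpair w).2).2 in
  [&& cvalid_prog p,
      ev B z fuel p == x.+1,
      ball_all fuel (fun i => cvalid_ideal Sigma (z i) &&
        ((cdist (z i) s * q2.+1 + q1 * (cden (z i) * cden s)) * 2 ^ i.+1
           <= cden (z i) * cden s * q2.+1))%N
    & (r1 * (cweight s x * q2.+1 + q1 * cden s) * 2 ^ clen p
         < r2.+1 * (cden s * q2.+1))%N].

Lemma rec_kraft_ball B :
  rec (fun o n => nat_of_bool (kraft_ball B (nunpair n).1 (nunpair n).2)).
Proof.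
rewrite /kraft_ball; apply: rec_and; first by rec_auto.
apply: rec_and; first by rec_auto.
apply: rec_and; last by rec_auto.
apply: (@rec_ball (fun o n i =>
  let s := cnth (nunpair n).1 3 in let q1 := cnth (nunpair n).1 4 in
  let q2 := cnth (nunpair n).1 5 in
  let z := cnth (nunpair (nunpair n).2).1 in
  cvalid_ideal Sigma (z i) &&
        ((cdist (z i) s * q2.+1 + q1 * (cden (z i) * cden s)) * 2 ^ i.+1
           <= cden (z i) * cden s * q2.+1)))%N.
  by rewrite /=; rec_auto.
by rec_auto.
Qed.

Lemma kraft_test_semicomputable : lower_semicomputable kraft_test.
Proof.
have [[[B BP] _] _] := T_optimal.
exists [set n | exists w, kraft_ball B n w].
  by apply: comp_enumerable_exists; exact: rec_kraft_ball.
move=> mu x r; rewrite kraft_test_gt; split=> [[p Tp lt]|]; last first.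
  move=> [s [q [[w]]]]; rewrite /kraft_ball !cnth_encode /=.
  set z := cnth _; set fuel := (nunpair (nunpair w).2).1.
  move=> /and4P[/cvalid_progP[p pE] /eqP evB /ball_allP zP lt] near.
  rewrite -pE clen_encode size_map -(ratioM_lt_exp2V R) ?cden_gt0 // in lt.
  exists p; last first.
    apply: le_lt_trans lt; apply: ler_wpM2l; first by rewrite divr_ge0.
    rewrite -(pr_ideal1 R).
    apply: (le_trans (pr_prokhorov mu (ideal_measure R s) [set x])).
    by rewrite prokhorovC lerD2l ltW.
  have [u uP] := @ideal_sequence R Sigma mu (fun i => i.+1).
  have [v vP] : exists v : nat -> seq (W * nat), forall i, (i < fuel)%N ->
      encode_ideal (v i) = z i.
    pose Q i s := (i < fuel)%N -> @encode_ideal Sigma s = z i.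
    have [|v vQ] := @choice _ _ Q; last by exists v.
    move=> i.
    have [ifuel|ge] := ltnP i fuel; last by exists [::]; rewrite /Q ltnNge ge.
    have /andP[/cvalid_idealP[t tz] _] := zP i ifuel.
    by exists t.
  (* The finite witness, continued by ideal measures close to [mu], is a name of [mu] that the
     computation cannot tell from the witness. *)
  pose y i := if (i < fuel)%N then v i else u i.
  have nz : name (fun i => encode_ideal (y i)) mu.
    apply: name_intro => i; rewrite /y; case: ifP => ifuel; last exact/ltW.
    have /andP[_] := zP i ifuel; rewrite -vP // -(ratioD_le_exp2V R); last first.
      by rewrite muln_gt0 !cden_gt0.
    rewrite -prokhorov_ideal -/(nnrat R q) => le.
    have := prokhorov_triangle (ideal_measure R s) (ideal_measure R (v i)) mu.
    by move: near; lra.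
  have /(BP _ _ nz)[x' Tp /encode_word_inj ->] //:
    computes (fun i => encode_ideal (y i)) B (encode_prog p) (encode_word x).
  rewrite pE; apply: ev_sound evB => i ifuel; rewrite /y ifuel; exact: vP.
(* Twice as close as [name_intro] requires: the other half of 2^-(i+1) is left for the ball around
   [s], whose radius 2^-k enters twice. This is why [k] below is at least [N + 3]. *)
have [u uP] := @ideal_sequence R Sigma mu (fun i => i.+2).
have nz : name (fun i => encode_ideal (u i)) mu.
  apply: name_intro => i; apply: ltW; apply: lt_le_trans (uP i) _.
  by apply: ler_wiXn2l => //; lra.
have /(BP _ _ nz)/ev_complete[N evB] :
  exists2 y, T p mu = Some y & encode_word x = encode_word y by exists x.
(* Passing from [mu] to the center [s] and then to any measure of the ball changes the probability
   of [x] by at most two radii, so a radius below [d] preserves the strict inequality. The summand 1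
   covers r = 0. *)
pose d := (2^-1 ^+ size p - nnrat R r * pr mu [set x]) / (nnrat R r *+ 2 + 1).
have r0 : 0 <= nnrat R r by rewrite divr_ge0.
have d0 : 0 < d by rewrite divr_gt0 ?subr_gt0 //; lra.
have [K KP] := exp2V_small d0.
pose k := maxn K (N + 3); pose q := (1, (2 ^ k).-1)%N.
have qE : nnrat R q = 2^-1 ^+ k.
  by rewrite /nnrat /= prednK ?expn_gt0 // natrX exprVn mul1r.
have qE' : 1%:R / (2 ^ k).-1.+1%:R = 2^-1 ^+ k :> R := qE.
have q0 : 0 < nnrat R q by rewrite qE exprn_gt0 // invr_gt0.
have [s sP] := ideal_dense mu q0.
exists s, q; split=> //; pose sigma := encode_seq [seq encode_ideal (u i) | i <- iota 0 N].
have sigmaE i : (i < N)%N -> cnth sigma i = encode_ideal (u i).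
  by move=> iN; rewrite cnth_encode (nth_map 0%N) ?size_iota // nth_iota.
exists (npair sigma (npair N (encode_prog p))).
rewrite /kraft_ball !cnth_encode !npairK /=; apply/and4P; split.
- exact: cvalid_encode_prog.
- by rewrite evB.
- apply/ball_allP => i iN; rewrite sigmaE // cvalid_encode_ideal /=.
  rewrite -(ratioD_le_exp2V R) ?muln_gt0 ?cden_gt0 // -prokhorov_ideal.
  have := prokhorov_triangle mu (ideal_measure R (u i)) (ideal_measure R s).
  rewrite (prokhorovC mu).
  have : 2^-1 ^+ k <= 2^-1 ^+ i.+3 :> R by apply: ler_wiXn2l; rewrite /k; [lra|lra|lia].
  by have := uP i; have := sP; rewrite qE qE' !exprS; lra.
- rewrite clen_encode size_map -(ratioM_lt_exp2V R) ?cden_gt0 // -(pr_ideal1 R).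
  have le := pr_prokhorov (ideal_measure R s) mu [set x].
  have := KP k (leq_maxl _ _); rewrite /d ltr_pdivlMr; last by lra.
  rewrite qE' -/(nnrat R r) => lt1; rewrite qE in sP q0.
  have : nnrat R r * (pr (ideal_measure R s) [set x] + 2^-1 ^+ k) <=
    nnrat R r * (pr mu [set x] + 2^-1 ^+ k *+ 2).
    by apply: ler_wpM2l => //; lra.
  by move: lt1; rewrite !mulrDr mulr1; lra.
Qed.

Lemma kraft_test_is_test : randomness_test kraft_test.
Proof.
split; [exact: kraft_test_ge0 | exact: kraft_test_semicomputable | exact: kraft_test_sum].
Qed.

End KraftTest.

(** * Layout of intervals with Lipschitz endpoints *)

Section Ramps.
Variables (R : realType) (g : nat -> nat -> nat -> bool) (b : nat -> nat).
Hypothesis b_le : forall i, (b i <= i)%N.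
Implicit Types (delta : nat -> R).

(** A tent function, positive exactly when the distance is below 2^-b. Its Lipschitz constant 2^b is
    at most 2^i by [b_le], which gives bounds in terms of the index alone. *)
Definition hat delta i : R := Num.max 0 (1 - 2 ^+ b i * delta i).

Definition ramp_sum delta c k j : R :=
  2 ^+ j * \sum_(i < j) (g c k i)%:R * hat delta i.

(* The factor [2 ^ j] makes a positive ramp at least double at each step until
   it reaches 1, hence one of its steps is at least 1/4. *)
Definition ramp delta c k j : R := Num.min 1 (ramp_sum delta c k j).

Lemma hat_ge0 delta i : 0 <= hat delta i.
Proof. by rewrite le_max lexx. Qed.

Lemma ramp_sum_ge0 delta c k j : 0 <= ramp_sum delta c k j.
Proof.
by rewrite mulr_ge0 ?exprn_ge0 // sumr_ge0 // => i _; rewrite mulr_ge0 ?hat_ge0.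
Qed.

Lemma ramp_sumS delta c k j : 2 * ramp_sum delta c k j <= ramp_sum delta c k j.+1.
Proof.
rewrite /ramp_sum mulrA -exprS ler_wpM2l ?exprn_ge0 // big_ord_recr /= lerDl.
by rewrite mulr_ge0 ?hat_ge0.
Qed.

Lemma ramp_ge0 delta c k j : 0 <= ramp delta c k j.
Proof. by rewrite le_min ler01 ramp_sum_ge0. Qed.

Lemma ramp_le1 delta c k j : ramp delta c k j <= 1.
Proof. by rewrite ge_min lexx. Qed.

Lemma ramp0 delta c k : ramp delta c k 0 = 0.
Proof. by rewrite /ramp /ramp_sum big_ord0 mulr0; apply/min_idPr; exact: ler01. Qed.

Lemma ramp_double delta c k j :
  Num.min 1 (2 * ramp delta c k j) <= ramp delta c k j.+1.
Proof.
have := ramp_sumS delta c k j; have := ramp_sum_ge0 delta c k j.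
rewrite /ramp; set s := ramp_sum _ _ _ _; set s' := ramp_sum _ _ _ _ => s0 ss'.
by case: (leP 1 s) => ?; case: (leP 1 s') => ?; case: (leP 1 (2 * _)) => ?; lra.
Qed.

Lemma ramp_leS delta c k j : ramp delta c k j <= ramp delta c k j.+1.
Proof.
have := ramp_double delta c k j; have := ramp_ge0 delta c k j.
by have := ramp_le1 delta c k j; case: (leP 1 (2 * _)) => ?; lra.
Qed.

Lemma ramp_gt0 delta c k i : g c k i -> 2 ^+ b i * delta i < 1 ->
  0 < ramp delta c k i.+1.
Proof.
move=> gi lt; rewrite lt_min ltr01 /= mulr_gt0 ?exprn_gt0 // big_ord_recr /= gi.
rewrite mul1r ltr_wpDl //; last by rewrite lt_max subr_gt0 lt orbT.
by apply: sumr_ge0 => m _; rewrite mulr_ge0 ?hat_ge0.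
Qed.

Lemma ramp_gt0_inv delta c k j : 0 < ramp delta c k j ->
  exists2 i, g c k i & 2 ^+ b i * delta i < 1.
Proof.
move=> rj; apply: contrapT => no; move: rj; rewrite lt_min => /andP[_].
rewrite /ramp_sum big1 ?mulr0 ?ltxx // => i _; case: (boolP (g c k i)) => gi.
  rewrite mul1r; apply/max_idPl; rewrite subr_le0 leNgt; apply/negP => lt.
  by apply: no; exists i.
by rewrite mul0r.
Qed.

(** At the first index where the ramp is at least 1/2, its previous value is below 1/2 and, by
    doubling, its next value is 1. These two steps cover more than 1/2, so one of them is at least
    1/4. *)
Lemma ramp_step delta c k j0 : 0 < ramp delta c k j0 ->
  exists j, 4^-1 <= ramp delta c k j.+1 - ramp delta c k j.
Proof.
set e := ramp delta c k => r0; have [m mP] := exp2V_small r0.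
have big : exists j, 2^-1 <= e j.
  exists (j0 + m)%N; suff : Num.min 1 (2 ^+ m * e j0) <= e (j0 + m)%N.
    have := mP m (leqnn m); rewrite exprVn invf_plt ?posrE ?exprn_gt0 //.
    by rewrite -[_^-1]div1r ltr_pdivrMr // => ?; case: (leP 1 (_ * _)) => ?; lra.
  elim: m {mP} => [|m IHm]; first by rewrite expr0 mul1r addn0 ge_min lexx orbT.
  rewrite addnS; have := ramp_double delta c k (j0 + m); rewrite -/e.
  by move: IHm; rewrite exprS -mulrA; case: (leP 1 (_ * e j0)) => ?;
    case: (leP 1 (2 * e _)) => ?; case: (leP 1 (2 * _)) => ?; lra.
have [j ej jmin] := ex_minnP big.
apply: contrapT => no; have {}no i : e i.+1 - e i < 4^-1.
  by rewrite ltNge; apply/negP => le; apply: no; exists i.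
have := no j; have := ramp_double delta c k j; have := ramp_le1 delta c k j.
rewrite -/e; case: j ej jmin => [|j] ej jmin.
  by move: ej; rewrite /e ramp0; lra.
have lt : e j < 2^-1 by rewrite ltNge; apply/negP => /jmin; rewrite ltnn.
by have := no j; case: (leP 1 (2 * _)) => ?; lra.
Qed.

Section Lipschitz.
Variables (delta delta' : nat -> R) (e : R).
Hypothesis close : forall c k i, g c k i -> `|delta i - delta' i| <= e.
Hypothesis e0 : 0 <= e.

Lemma hat_lipschitz c k i : g c k i -> `|hat delta i - hat delta' i| <= 2 ^+ b i * e.
Proof.
move=> /close le; have p0 : 0 < 2 ^+ b i :> R by rewrite exprn_gt0.
have : `|2 ^+ b i * delta i - 2 ^+ b i * delta' i| <= 2 ^+ b i * e.
  by rewrite -mulrBr normrM gtr0_norm // ler_pM2l.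
rewrite /hat; set x := 2 ^+ _ * _; set y := 2 ^+ _ * delta' _; rewrite !ler_norml.
by case: (leP 0 (1 - x)) => ?; case: (leP 0 (1 - y)) => ?; lra.
Qed.

(** Three factors 2^j: the one in [ramp_sum], a bound on the number j of terms, and a bound on the
    Lipschitz constant of each hat. *)
Lemma ramp_sum_lipschitz c k j :
  `|ramp_sum delta c k j - ramp_sum delta' c k j| <= 8 ^+ j * e.
Proof.
rewrite /ramp_sum -mulrBr -sumrB normrM ger0_norm ?exprn_ge0 //.
have : `|\sum_(i < j) ((g c k i)%:R * hat delta i - (g c k i)%:R * hat delta' i)|
    <= \sum_(i < j) 2 ^+ j * e.
  apply: le_trans (ler_norm_sum _ _ _) _; apply: ler_sum => i _.
  rewrite -mulrBr; case: (boolP (g c k i)) => gi; last first.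
    by rewrite mul0r normr0 mulr_ge0 ?exprn_ge0.
  rewrite mul1r; apply: le_trans (hat_lipschitz gi) _; apply: ler_wpM2r => //.
  by apply: ler_weXn2l; [lra | exact: leq_trans (b_le i) (ltnW (ltn_ord i))].
rewrite sumr_const card_ord -[X in _ <= X -> _]mulr_natl => le.
have j2 : j%:R <= 2 ^+ j :> R by rewrite -natrX ler_nat ltnW // ltn_expl.
have -> : 8 ^+ j = 2 ^+ j * (2 ^+ j * 2 ^+ j) :> R.
  by rewrite -!exprMn; congr (_ ^+ _); lra.
rewrite -[leRHS]mulrA ler_pM2l ?exprn_gt0 //; apply: (le_trans le).
by rewrite -mulrA ler_wpM2r // mulr_ge0 ?exprn_ge0.
Qed.

Lemma ramp_lipschitz c k j : `|ramp delta c k j - ramp delta' c k j| <= 8 ^+ j * e.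
Proof.
have := ramp_sum_lipschitz c k j.
rewrite /ramp; set x := ramp_sum _ _ _ _; set y := ramp_sum _ _ _ _; rewrite !ler_norml.
by case: (leP 1 x) => ?; case: (leP 1 y) => ?; lra.
Qed.
End Lipschitz.

(* The piece of index [npair c (npair k j)] is the [j]-th step of the ramp of
   [c] at scale [2^-(k+1)]. *)
Definition piece_word (n : nat) : nat := (nunpair n).1.
Definition piece_scale (n : nat) : nat := (nunpair (nunpair n).2).1.
Definition piece_step (n : nat) : nat := (nunpair (nunpair n).2).2.

Lemma piece_scale_le n : (piece_scale n <= n)%N.
Proof. exact: leq_trans (nunpair_le1 _) (nunpair_le2 _). Qed.

Lemma piece_step_le n : (piece_step n <= n)%N.
Proof. exact: leq_trans (nunpair_le2 _) (nunpair_le2 _). Qed.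

Definition piece delta n : R := 2^-1 ^+ (piece_scale n).+1 *
  (ramp delta (piece_word n) (piece_scale n) (piece_step n).+1 -
   ramp delta (piece_word n) (piece_scale n) (piece_step n)).

Definition left_end delta n : R := \sum_(i < n) piece delta i.

Lemma piece_ge0 delta n : 0 <= piece delta n.
Proof. by rewrite mulr_ge0 ?exprn_ge0 ?invr_ge0 // subr_ge0 ramp_leS. Qed.

Lemma left_endS delta n : left_end delta n.+1 = left_end delta n + piece delta n.
Proof. by rewrite /left_end big_ord_recr. Qed.

Lemma left_end_ge0 delta n : 0 <= left_end delta n.
Proof. by apply: sumr_ge0 => i _; exact: piece_ge0. Qed.

Lemma left_end_homo delta m n : (m <= n)%N -> left_end delta m <= left_end delta n.
Proof.
move=> /subnK <-; elim: (n - m)%N => [|i IHi] //=.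
by rewrite addSn left_endS; apply: (le_trans IHi); rewrite lerDl piece_ge0.
Qed.

(** Each of at most 2^n pieces contributes 8^n: the 2 from the difference of two ramps cancels
    against the weight 2^-(k+1) <= 1/2. Closeness is asked only at good indices, as the ramps ignore
    the others. *)
Lemma left_end_lipschitz delta delta' e n :
  (forall c k i, g c k i -> `|delta i - delta' i| <= e) -> 0 <= e ->
  `|left_end delta n - left_end delta' n| <= 16 ^+ n * e.
Proof.
move=> close e0; rewrite /left_end -sumrB.
have : `|\sum_(i < n) (piece delta i - piece delta' i)| <= \sum_(i < n) 8 ^+ n * e.
  apply: le_trans (ler_norm_sum _ _ _) _; apply: ler_sum => i _.
  rewrite /piece -mulrBr normrM ger0_norm ?exprn_ge0 ?invr_ge0 //.
  have := ramp_lipschitz close e0 (piece_word i) (piece_scale i) (piece_step i).+1.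
  have := ramp_lipschitz close e0 (piece_word i) (piece_scale i) (piece_step i).
  set r1 := ramp _ _ _ _; set r2 := ramp _ _ _ _; set r3 := ramp _ _ _ _.
  set r4 := ramp _ _ _ _ => le1 le2.
  have le : `|r3 - r1 - (r4 - r2)| <= 2 * (8 ^+ (piece_step i).+1 * e).
    apply: (@le_trans _ _ (`|r3 - r4| + `|r1 - r2|)).
      by rewrite (_ : _ - _ - _ = r3 - r4 - (r1 - r2)) ?ler_normB //; ring.
    have : 8 ^+ (piece_step i) * e <= 8 ^+ (piece_step i).+1 * e.
      by rewrite ler_wpM2r // exprS ler_peMl ?exprn_ge0 //; lra.
    lra.
  have p2 : 2^-1 ^+ (piece_scale i).+1 <= 2^-1 :> R.
    by rewrite exprS ler_piMr ?invr_ge0 // exprn_ile1 ?invr_ge0 //; lra.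
  apply: (@le_trans _ _ (2^-1 * (2 * (8 ^+ (piece_step i).+1 * e)))).
    by apply: ler_pM => //; rewrite exprn_ge0 ?invr_ge0.
  rewrite mulKf ?pnatr_eq0 //; apply: ler_wpM2r => //; apply: ler_weXn2l; first lra.
  exact: leq_ltn_trans (piece_step_le i) (ltn_ord i).
rewrite sumr_const card_ord -[X in _ <= X -> _]mulr_natl => /le_trans; apply.
have n2 : n%:R <= 2 ^+ n :> R by rewrite -natrX ler_nat ltnW // ltn_expl.
have -> : 16 ^+ n = 2 ^+ n * 8 ^+ n :> R by rewrite -exprMn; congr (_ ^+ _); lra.
by rewrite -mulrA ler_wpM2r // mulr_ge0 ?exprn_ge0.
Qed.

(** Numerator over 2^M of the ramp for the distances [D i] / 2^M; truncated subtraction is the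
    maximum with 0 in [hat]. *)
Definition cramp (D : nat -> nat) (M c k j : nat) : nat :=
  minn (2 ^ M) (2 ^ j * bsum j (fun i => g c k i * (2 ^ M - 2 ^ b i * D i)))%N.

(** Numerator over 2^(M+N). The exponent [N - (piece_scale i).+1] is exact for [n <= N], because a
    scale is at most the index of its piece. *)
Definition cleft (D : nat -> nat) (M N n : nat) : nat :=
  bsum n (fun i => 2 ^ (N - (piece_scale i).+1) *
    (cramp D M (piece_word i) (piece_scale i) (piece_step i).+1 -
     cramp D M (piece_word i) (piece_scale i) (piece_step i)))%N.

Lemma crampE D M c k j :
  ramp (fun i => (D i)%:R / 2 ^+ M) c k j = (cramp D M c k j)%:R / 2 ^+ M.
Proof.
have M0 : 0 < 2 ^+ M :> R by rewrite exprn_gt0.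
rewrite /ramp (_ : ramp_sum _ c k j =
   (2 ^ j * bsum j (fun i => g c k i * (2 ^ M - 2 ^ b i * D i)))%N%:R / 2 ^+ M).
  have E1 : 1 = (2 ^ M)%:R / 2 ^+ M :> R by rewrite natrX divff ?gt_eqF.
  rewrite /cramp [X in Num.min X _]E1; set s := (2 ^ j * _)%N.
  have [le|/ltnW le] := leqP (2 ^ M) s; [apply/min_idPl | apply/min_idPr];
    by rewrite ler_pM2r ?invr_gt0 // ler_nat.
rewrite /ramp_sum natrM natrX -mulrA; congr (_ * _).
rewrite /bsum natr_sum mulr_suml; apply: eq_bigr => i _.
rewrite natrM -mulrA; congr (_ * _); rewrite /hat mulrA -natrX -natrM.
have [le|/ltnW le] := leqP (2 ^ b i * D i) (2 ^ M).
  rewrite natrB // natrX mulrBl divff ?gt_eqF //; apply/max_idPr.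
  by rewrite subr_ge0 ler_pdivrMr // mul1r -natrX ler_nat.
have -> : (2 ^ M - 2 ^ b i * D i = 0)%N by lia.
rewrite mul0r; apply/max_idPl.
by rewrite subr_le0 ler_pdivlMr // mul1r -natrX ler_nat.
Qed.

Lemma cleftE D M N n : (n <= N)%N ->
  left_end (fun i => (D i)%:R / 2 ^+ M) n = (cleft D M N n)%:R / 2 ^+ (M + N).
Proof.
move=> nN; rewrite /left_end /cleft /bsum natr_sum mulr_suml; apply: eq_bigr => i _.
rewrite /piece !crampE -mulrBl natrM natrB; last first.
  have M0 : 0 < 2 ^+ M :> R by rewrite exprn_gt0.
  by rewrite -(ler_nat R) -(ler_pM2r (x := (2 ^+ M)^-1)) ?invr_gt0 // -!crampE ramp_leS.
have sN : ((piece_scale i).+1 <= N)%N.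
  exact: leq_ltn_trans (piece_scale_le i) (leq_trans (ltn_ord i) nN).
have -> : 2^-1 ^+ (piece_scale i).+1 = (2 ^ (N - (piece_scale i).+1))%:R / 2 ^+ N :> R.
  rewrite natrX exprVn; apply: (canRL (mulfK _)); first by rewrite expf_neq0.
  by rewrite -[in 2 ^+ N](subnK sN) exprD mulrCA mulVf ?mulr1 // expf_neq0.
by rewrite exprD invfM; ring.
Qed.

End Ramps.

(** * Dyadic intervals *)

Fixpoint bval (p : seq bool) : nat := if p is b :: q then b * 2 ^ size q + bval q else 0.

Lemma bval_lt p : (bval p < 2 ^ size p)%N.
Proof. by elim: p => //= b p IHp; rewrite expnS; case: b; lia. Qed.

Lemma bval_cat p q : bval (p ++ q) = (bval p * 2 ^ size q + bval q)%N.
Proof.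
by elim: p => //= b p ->; rewrite size_cat expnD mulnDl mulnA addnA.
Qed.

Lemma bval_surj l v : (v < 2 ^ l)%N -> exists2 p, size p = l & bval p = v.
Proof.
elim: l v => [|l IHl] v; first by case: v => // _; exists [::].
rewrite expnS => lt; have [le|gt] := leqP (2 ^ l) v.
  have [|p pl pv] := IHl (v - 2 ^ l)%N; first by lia.
  by exists (true :: p); rewrite /= ?pl // pv mul1n subnKC.
by have [p pl pv] := IHl v gt; exists (false :: p); rewrite /= ?pl.
Qed.

Definition cval (c : nat) : nat := bsum c (fun i => cnth c i * 2 ^ (clen c - i.+1))%N.

Lemma cval_encode p : cval (encode_prog p) = bval p.
Proof.
rewrite /cval (@bsum_seq _ _ (iota 0 (size p))) ?iota_uniq //; first last.
- move=> i _; rewrite mem_iota /= add0n -leqNgt => pi.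
  by rewrite cnth_encode nth_default ?size_map.
- move=> i; rewrite mem_iota /= add0n => lt.
  by apply: (leq_trans lt); have := size_encode (map nat_of_bool p); rewrite size_map.
rewrite clen_encode size_map; elim: p => [|b p IHp] /=; first by rewrite big_nil.
rewrite big_cons cnth_encode /= subn1 -IHp; congr addn.
rewrite -[1%N]addn0 iotaDl big_map; apply: eq_big_seq => i _.
by rewrite !cnth_encode /= add1n subSS.
Qed.

Lemma rec_cval F : rec F -> rec (fun o e => cval (F o e)).
Proof.
move=> rF; apply: (@rec_comp (fun o e => cval e)) => //; rewrite /cval.
by apply: (@rec_sum (fun o e i => cnth e i * 2 ^ (clen e - i.+1))%N); rec_auto.
Qed.
#[export] Hint Resolve rec_cval : rec.

Section Inside.
Variable (R : realType).
Implicit Types (a b : R).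

(* The closed dyadic interval of [p] lies inside the open interval (a, b). *)
Definition inside (p : seq bool) a b : Prop :=
  a < (bval p)%:R / 2 ^+ size p /\ (bval p).+1%:R / 2 ^+ size p < b.

(** The dyadic cell after the one containing [a] starts strictly above [a] and ends at most two
    cells beyond it. The bound [b <= 1] makes its number fit in [l] bits. *)
Lemma inside_exists a b l : 0 <= a -> b <= 1 -> 4 * 2^-1 ^+ l <= b - a ->
  exists2 p, size p = l & inside p a b.
Proof.
move=> a0 b1 ab; have l0 : 0 < 2 ^+ l :> R by rewrite exprn_gt0.
have /truncn_itv/andP[] : 0 <= a * 2 ^+ l by rewrite mulr_ge0 // ltW.
set v := Num.truncn _ => va av.
have ab' : 4 <= (b - a) * 2 ^+ l by rewrite -ler_pdivrMr // -exprVn.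
have bl : b * 2 ^+ l <= 2 ^+ l by rewrite ler_piMl // ltW.
have vb : v.+2%:R < b * 2 ^+ l.
  by move: ab'; rewrite mulrBl -[v.+2%:R]natr1 -[v.+1%:R]natr1; lra.
have vl : (v.+1 < 2 ^ l)%N by rewrite -(ltr_nat R) natrX -[v.+1%:R]natr1; move: vb;
  rewrite -[v.+2%:R]natr1 -[v.+1%:R]natr1; lra.
have [p pl pv] := bval_surj vl; exists p => //.
by rewrite /inside pl pv; split; rewrite ?ltr_pdivlMr ?ltr_pdivrMr.
Qed.

(** The cell of an extension lies in the cell of its prefix, so the two open intervals meet. For
    consecutive intervals this forces them to be the same. *)
Lemma inside_prefix p q a b c d : prefix p q -> inside p a b -> inside q c d ->
  a < d /\ c < b.
Proof.
move=> /prefixP[r ->] [ap pb] [cq qd].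
have p0 : 0 < 2 ^+ size p :> R by rewrite exprn_gt0.
have r0 : 0 < 2 ^+ size r :> R by rewrite exprn_gt0.
have q0 : 0 < 2 ^+ size (p ++ r) :> R by rewrite exprn_gt0.
have F n : n%:R / 2 ^+ size p = (n * 2 ^ size r)%:R / 2 ^+ size (p ++ r) :> R.
  by rewrite size_cat exprD natrM natrX -mulf_div divff ?mulr1 // gt_eqF.
split.
  apply: (lt_trans ap); apply: le_lt_trans qd; rewrite F.
  by rewrite ler_pM2r ?invr_gt0 // ler_nat bval_cat leqW // leq_addr.
apply: (lt_trans cq); apply: le_lt_trans pb; rewrite F.
by rewrite ler_pM2r ?invr_gt0 // ler_nat bval_cat mulSn [leqLHS]addnC leq_add2r ltnW ?bval_lt.
Qed.

End Inside.

(** * Coding a uniformly lower semicomputable family of semimeasures *)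

Lemma cnth_le s i : (cnth s i <= s)%N.
Proof.
have [l <-] := encode_seq_surj s; rewrite cnth_encode.
elim: l i => [|a l IHl] [|i] //=; first by have := npair_ge a (encode_seq l); lia.
by have := IHl i; have := npair_ge a (encode_seq l); lia.
Qed.

(* A ball index encodes [nu; b; a; s; q1; q2; fuel].  It is good for the word
   [x] at scale [k] if, within the given fuel, the enumeration [c] produces the
   ball of center [s] and radius [q] for the level [2^a / 2^k], this ball
   contains the ball of center [nu] and radius [2^-b], and the measures in the
   latter ball give [x] more than [2^-a]; there the product of the test and of
   the probability of [x] exceeds [2^-k]. *)
Definition cgood (Sigma : finType) (c : Defs.code) (x k i : nat) : bool :=
  let nu := cnth i 0 in let b := cnth i 1 in let a := cnth i 2 in
  let s := cnth i 3 in let q1 := cnth i 4 in let q2 := cnth i 5 in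
  [&& cvalid_word Sigma x, cvalid_ideal Sigma nu, cvalid_ideal Sigma s,
      0 < ev c (cnth 0) (cnth i 6)
             (encode_seq [:: x; 2 ^ a; (2 ^ k).-1; s; q1; q2]),
      (cdist s nu * 2 ^ b + cden s * cden nu) * q2.+1
        <= q1 * (2 ^ b * (cden s * cden nu))
    & (2 ^ b + 2 ^ a) * cden nu <= cweight nu x * 2 ^ (a + b)]%N.

Definition cradius (i : nat) : nat := cnth i 1.

Lemma cradius_le i : (cradius i <= i)%N. Proof. exact: cnth_le. Qed.

(* The distance of the center of [i] to the ideal measure with code [s],
   rounded down to a multiple of 2^-M. *)
Definition cfloor (s M i : nat) : nat :=
  ((2 ^ M * cdist (cnth i 0) s) %/ (cden (cnth i 0) * cden s))%N.

(* [n] is the index of a piece and [z] a name; the approximation of the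
   measure is [z M], and [2 * 16 ^ n.+1 / 2 ^ M] bounds the error on the end
   points of the piece. *)
Definition cinside (Sigma : finType) (c : Defs.code) (z : nat -> nat) (p w : nat) : bool :=
  let n := (nunpair w).1 in let M := (nunpair w).2 in
  let left := cleft (cgood Sigma c) cradius (cfloor (z M) M) M n.+1 in
  [&& clen p == piece_scale n + 5,
      (left n + 2 * 16 ^ n.+1 * 2 ^ n.+1) * 2 ^ clen p < cval p * 2 ^ (M + n.+1)
    & (cval p).+1 * 2 ^ (M + n.+1) + 2 * 16 ^ n.+1 * 2 ^ n.+1 * 2 ^ clen p
        < left n.+1 * 2 ^ clen p]%N.

Section RecInside.
Variables (Sigma : finType) (c : Defs.code).
Local Open Scope nat_scope.

Lemma rec_cgood X K I : rec X -> rec K -> rec I ->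
  rec (fun o e => nat_of_bool (cgood Sigma c (X o e) (K o e) (I o e))).
Proof.
move=> rX rK rI; rewrite /cgood /=.
do 3 (apply: rec_and; first by rec_auto).
apply: rec_and.
  apply: rec_ltn; first by rec_auto.
  by apply: (@rec_ev c (fun _ _ => 0)); rec_auto.
by apply: rec_and; rec_auto.
Qed.

Lemma rec_cfloor S M I : rec S -> rec M -> rec I ->
  rec (fun o e => cfloor (S o e) (M o e) (I o e)).
Proof. by move=> rS rM rI; rewrite /cfloor; rec_auto. Qed.

Lemma rec_cramp S M X K J : rec S -> rec M -> rec X -> rec K -> rec J ->
  rec (fun o e => cramp (cgood Sigma c) cradius (cfloor (S o e) (M o e))
                        (M o e) (X o e) (K o e) (J o e)).
Proof.
move=> rS rM rX rK rJ; rewrite /cramp.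
have sum : rec (fun o e => bsum (J o e) (fun i => cgood Sigma c (X o e) (K o e) i *
    (2 ^ M o e - 2 ^ cradius i * cfloor (S o e) (M o e) i))).
  apply: rec_sum rJ; have r1 := rec_fst rec_id; have r2 := rec_snd rec_id.
  have rS' := rec_comp rS r1; have rM' := rec_comp rM r1.
  have rX' := rec_comp rX r1; have rK' := rec_comp rK r1.
  have rg := rec_cgood rX' rK' r2; have rf := rec_cfloor rS' rM' r2.
  by rewrite /cradius; rec_auto.
by rewrite /minn; rec_auto.
Qed.

Lemma rec_cleft S M N n : rec S -> rec M -> rec N -> rec n ->
  rec (fun o e => cleft (cgood Sigma c) cradius (cfloor (S o e) (M o e))
                        (M o e) (N o e) (n o e)).
Proof.
move=> rS rM rN rn; apply: rec_sum rn.
have r1 := rec_fst rec_id; have r2 := rec_snd rec_id.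
have rS' := rec_comp rS r1; have rM' := rec_comp rM r1; have rN' := rec_comp rN r1.
rewrite /piece_word /piece_scale /piece_step.
by apply: rec_mul; [rec_auto | apply: rec_sub; apply: rec_cramp; rec_auto].
Qed.

Lemma rec_cinside :
  rec (fun o n => nat_of_bool (cinside Sigma c o (nunpair n).1 (nunpair n).2)).
Proof.
rewrite /cinside /=; have rw := rec_snd rec_id; have rp := rec_fst rec_id.
have rn := rec_fst rw; have rM := rec_snd rw; have rz := rec_oracle rM.
have rl1 := rec_cleft rz rM (rec_succ rn) rn.
have rl2 := rec_cleft rz rM (rec_succ rn) (rec_succ rn).
rewrite /piece_scale; apply: rec_and; first by rec_auto.
by apply: rec_and; apply: rec_ltn; rec_auto.
Qed.
End RecInside.

(** * Sums over pairs and over dyadic scales *)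

Lemma ler_sum_subset (R : numDomainType) (T : eqType) (l1 l2 : seq T) (F : T -> R) :
  uniq l1 -> {subset l1 <= l2} -> (forall x, 0 <= F x) ->
  \sum_(x <- l1) F x <= \sum_(x <- l2) F x.
Proof.
move=> u1 sub F0; elim: l1 l2 u1 sub => [|x l1 IHl1] l2.
  by move=> _ _; rewrite big_nil sumr_ge0.
move=> /= /andP[xl1 u1] sub; have xl2 := sub x (mem_head _ _).
rewrite big_cons (perm_big _ (perm_to_rem xl2)) big_cons lerD2l; apply: IHl1 => // y yl1.
apply: rem_mem; last by apply: sub; rewrite inE yl1 orbT.
by apply: contraNneq xl1 => <-.
Qed.

Lemma sum_ord_iota (R : nmodType) (f : nat -> R) N :
  \sum_(i < N) f i = \sum_(i <- iota 0 N) f i.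
Proof. by rewrite -(big_mkord xpredT) /index_iota subn0. Qed.

(** Both components of a pair are at most its code, so the pairs with code below [N] lie in a
    square. *)
Lemma sum_nunpair_le (R : numDomainType) (F : nat * nat -> R) N : (forall a, 0 <= F a) ->
  \sum_(n < N) F (nunpair n) <= \sum_(a < N) \sum_(b < N) F (nat_of_ord a, nat_of_ord b).
Proof.
move=> F0; rewrite (sum_ord_iota (fun n => F (nunpair n))).
rewrite (sum_ord_iota (fun a => \sum_(b < N) F (a, nat_of_ord b))).
under [leRHS]eq_bigr => a _ do rewrite (sum_ord_iota (fun b => F (a, b))).
rewrite -(big_allpairs (F := F)) -(big_map nunpair xpredT F).
apply: ler_sum_subset => //.
  rewrite map_inj_uniq ?iota_uniq // => m n E.
  by rewrite -(nunpairK m) -(nunpairK n) E.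
move=> _ /mapP[n + ->]; rewrite mem_iota add0n /= => nN.
apply/allpairsP; exists (nunpair n); rewrite !mem_iota !add0n /=.
rewrite -surjective_pairing; split=> //.
  exact: leq_ltn_trans (nunpair_le1 n) nN.
exact: leq_ltn_trans (nunpair_le2 n) nN.
Qed.

(** The minimum with 1 carries the induction: without the term k = 0, the sum is half of the sum for
    2m. *)
Lemma geometric_tail (R : realFieldType) (m : R) N : 0 <= m ->
  \sum_(k < N) (2^-1 ^+ k < m)%R%:R * 2^-1 ^+ k.+1 <= Num.min 1 m.
Proof.
elim: N m => [|N IHN] m m0; first by rewrite big_ord0 le_min ler01.
rewrite big_ord_recl /= expr0 expr1.
have -> : \sum_(i < N) (2^-1 ^+ lift ord0 i < m)%R%:R * 2^-1 ^+ (lift ord0 i).+1 =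
    2^-1 * \sum_(k < N) (2^-1 ^+ k < 2 * m)%R%:R * 2^-1 ^+ k.+1 :> R.
  rewrite mulr_sumr; apply: eq_bigr => i _; rewrite /lift /= /bump /= add1n.
  by rewrite [RHS]mulrCA -exprS exprS ltr_pdivrMl.
have := IHN (2 * m) ltac:(lra); set s := \sum_(k < N) _.
by case: (ltP 1 m) => ?; case: (leP 1 (2 * m)) => ?; rewrite ?mul1r ?mul0r; lra.
Qed.

Lemma dyadic_scale (R : realType) (r : R) : 0 < r -> r <= 1 ->
  exists a, 2^-1 ^+ a < r /\ r <= 2 * 2^-1 ^+ a.
Proof.
move=> r0 r1; have [n nP] := exp2V_small r0.
have ex : exists a, 2^-1 ^+ a < r by exists n; exact: nP.
have [a ar amin] := ex_minnP ex; exists a; split=> //.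
case: a ar amin => [|a] ar amin; first by move: ar; rewrite expr0; lra.
rewrite exprS mulVKf ?pnatr_eq0 // leNgt; apply/negP => /amin.
by rewrite ltnn.
Qed.

Lemma dyadic_lt (R : realFieldType) (a A v l : nat) :
  (a%:R / 2 ^+ A < v%:R / 2 ^+ l :> R) = (a * 2 ^ l < v * 2 ^ A)%N.
Proof.
rewrite ltr_pdivrMr ?exprn_gt0 // mulrAC ltr_pdivlMr ?exprn_gt0 //.
by rewrite -!natrX -!natrM ltr_nat.
Qed.

(** * The upper bound: a prefix code built from a test *)

Section Coding.
Variables (R : realType) (Sigma : finType).
Local Notation W := (word Sigma).
Local Notation M := (probability W R).
Variable t : M -> W -> \bar R.
Hypothesis t_ge0 : forall mu x, (0 <= t mu x)%E.
Hypothesis t_sum : forall mu : M, (\esum_(x in [set: W]) (mu [set x] * t mu x) <= 1)%E.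
Variable c : Defs.code.
Hypothesis t_enum : forall (mu : M) (x : W) (r : nat * nat),
  ((nnrat R r)%:E < t mu x)%E <-> exists s q,
    (exists fuel, (0 < ev c (cnth 0) fuel (encode_seq
      [:: encode_word x; r.1; r.2; encode_ideal s; q.1; q.2]))%N) /\
    prokhorov (ideal_measure R s) mu < nnrat R q.

(** Taking the finite part loses nothing: the terms of a mean bounded by 1 are finite, an infinite
    value of the test meeting probability 0. *)
Definition mass (mu : M) (x : W) : R := fine (mu [set x] * t mu x)%E.

Lemma mass_term_ge0 (mu : M) (x : W) : (0 <= mu [set x] * t mu x)%E.
Proof. by rewrite mule_ge0. Qed.

Lemma massE (mu : M) (x : W) : (mu [set x] * t mu x)%E = (mass mu x)%:E.
Proof.
rewrite /mass fineK // ge0_fin_numE ?mass_term_ge0 //.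
have := seq_le_esum (fun x => mu [set x] * t mu x)%E (isT : uniq [:: x]).
rewrite big_seq1 => le; apply: (le_lt_trans le); apply: (le_lt_trans (t_sum mu)).
exact: ltry.
Qed.

Lemma mass_ge0 (mu : M) (x : W) : 0 <= mass mu x.
Proof. by rewrite -lee_fin -massE mass_term_ge0. Qed.

Lemma mass_sum (mu : M) (U : seq W) : uniq U -> \sum_(x <- U) mass mu x <= 1.
Proof.
move=> uU; rewrite -lee_fin -sumEFin.
rewrite (eq_bigr (fun x => mu [set x] * t mu x)%E) => [|x _]; last by rewrite massE.
exact: le_trans (seq_le_esum _ uU) (t_sum mu).
Qed.

Lemma mass_le1 (mu : M) (x : W) : mass mu x <= 1.
Proof. by have := @mass_sum mu [:: x] isT; rewrite big_seq1. Qed.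

Lemma mass_gt0_test (mu : M) (x : W) : 0 < pr mu [set x] ->
  exists2 r : R, t mu x = r%:E & mass mu x = pr mu [set x] * r.
Proof.
move=> m0; have := massE mu x; have := t_ge0 mu x; rewrite prE.
case: (t mu x) => [r| |] // _; last by rewrite gt0_muley ?lte_fin.
by rewrite -EFinM => -[<-]; exists r.
Qed.

Definition ideal_of (s : nat) : seq (W * nat) := xget [::] [set u | encode_ideal u = s].

Lemma ideal_of_encode u : ideal_of (encode_ideal u) = u.
Proof.
apply: encode_ideal_inj.
exact: (@xgetPex _ [::] [set v | encode_ideal v = encode_ideal u] (ex_intro _ u erefl)).
Qed.

Definition distance (mu : M) (i : nat) : R :=
  prokhorov (ideal_measure R (ideal_of (cnth i 0))) mu.

Local Notation good := (cgood Sigma c).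

Lemma nnrat_exp2 a k : nnrat R (2 ^ a, (2 ^ k).-1)%N = 2 ^+ a * 2^-1 ^+ k.
Proof. by rewrite /nnrat /= prednK ?expn_gt0 // !natrX exprVn. Qed.

Lemma good_sound (mu : M) x k i : good x k i -> 2 ^+ cradius i * distance mu i < 1 ->
  exists2 y : W, encode_word y = x & 2^-1 ^+ k < mass mu y.
Proof.
rewrite /cgood /distance /cradius; set b := cnth i 1; set a := cnth i 2.
case/and5P => /cvalid_wordP[y <-] /cvalid_idealP[v vE] /cvalid_idealP[u uE] enum.
rewrite -vE -uE ideal_of_encode => /andP[radius weight] near; exists y => //.
have b0 : 0 < 2 ^+ b :> R by rewrite exprn_gt0.
have {}near : prokhorov (ideal_measure R v) mu < 2^-1 ^+ b.
  by rewrite exprVn -[_^-1]mul1r ltr_pdivlMr // mulrC.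
have {}radius : prokhorov (ideal_measure R u) (ideal_measure R v) + 2^-1 ^+ b <=
    nnrat R (cnth i 4, cnth i 5).
  rewrite prokhorov_ideal exprVn -[X in _ + X]div1r -natrX addf_div; last 2 first.
  - by rewrite pnatr_eq0 -lt0n muln_gt0 !cden_gt0.
  - by rewrite pnatr_eq0 -lt0n expn_gt0.
  rewrite /nnrat ler_pdivrMr; last by rewrite -natrM ltr0n !muln_gt0 !cden_gt0 expn_gt0.
  rewrite mulrAC ler_pdivlMr // mul1r -!natrM -natrD -!natrM ler_nat.
  by rewrite [(cden _ * cden _ * 2 ^ b)%N]mulnC.
have {}weight : 2^-1 ^+ a + 2^-1 ^+ b <= pr (ideal_measure R v) [set y].
  rewrite pr_ideal1 !exprVn -[X in X + _]div1r -[X in _ + X]div1r addf_div ?expf_neq0 //.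
  rewrite ler_pdivrMr ?mulr_gt0 ?exprn_gt0 // mulrAC ler_pdivlMr ?ltr0n ?cden_gt0 //.
  by rewrite !mul1r -exprD -!natrX -natrD -!natrM ler_nat.
have := pr_prokhorov (ideal_measure R v) mu [set y].
have /t_enum : exists s q, (exists fuel, (0 < ev c (cnth 0) fuel (encode_seq
      [:: encode_word y; (2 ^ a, (2 ^ k).-1).1; (2 ^ a, (2 ^ k).-1).2;
          encode_ideal s; q.1; q.2]))%N) /\ prokhorov (ideal_measure R s) mu < nnrat R q.
  exists u, (cnth i 4, cnth i 5); split; first by exists (cnth i 6); rewrite uE.
  have := prokhorov_triangle (ideal_measure R v) (ideal_measure R u) mu; lra.
rewrite nnrat_exp2 => lt le; have [|r tr ->] := @mass_gt0_test mu y.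
  by have : 0 < 2^-1 ^+ a :> R; [rewrite exprn_gt0 | lra].
move: lt; rewrite tr lte_fin => lt.
have -> : 2^-1 ^+ k = 2^-1 ^+ a * (2 ^+ a * 2^-1 ^+ k) :> R.
  by rewrite mulrA -exprMn mulVf ?pnatr_eq0 // expr1n mul1r.
by apply: ltr_pM => //; rewrite ?mulr_ge0 ?exprn_ge0 ?invr_ge0 //; lra.
Qed.

(** With 2^-a < mu(y) <= 2 * 2^-a, the test exceeds 2^a / 2^k, because the factor 4 covers the loss
    of a factor 2 in rounding mu(y). *)
Lemma good_complete (mu : M) (y : W) k : 4 * 2^-1 ^+ k < mass mu y ->
  exists2 i, good (encode_word y) k i & 2 ^+ cradius i * distance mu i < 1.
Proof.
move=> lt; have k0 : 0 < 2^-1 ^+ k :> R by rewrite exprn_gt0 // invr_gt0.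
have m0 : 0 < pr mu [set y].
  rewrite lt_def pr_ge0 andbT; apply: contraTneq lt => m0.
  have /eqP := massE mu y; rewrite prE m0 mul0e eqe => /eqP <-.
  by rewrite -leNgt; lra.
have [a [am ma]] := dyadic_scale m0 (pr_le1 _ _).
have [r tr mr] := mass_gt0_test m0.
have a0 : 0 < 2^-1 ^+ a :> R by rewrite exprn_gt0 // invr_gt0.
have a20 : 0 < 2 ^+ a :> R by rewrite exprn_gt0.
have E : 2 ^+ a * 2^-1 ^+ a = 1 :> R by rewrite -exprMn divff ?expr1n // pnatr_eq0.
have /t_enum[u [q [[fuel enum] near]]] : ((nnrat R (2 ^ a, (2 ^ k).-1)%N)%:E < t mu y)%E.
  rewrite nnrat_exp2 tr lte_fin; rewrite mr in lt.
  have r0 : 0 < r by rewrite -(pmulr_rgt0 _ m0); lra.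
  have : 4 * 2^-1 ^+ k < 2 * 2^-1 ^+ a * r.
    by apply: (lt_le_trans lt); rewrite ler_pM2r.
  rewrite -(ltr_pM2l a20); move: E; nra.
(* The slack in the two strict conditions. Half of it bounds 2^-b, which is spent twice: on the
   distance from [mu] to the new center and on the radius around that center. *)
pose d := Num.min (nnrat R q - prokhorov (ideal_measure R u) mu) (pr mu [set y] - 2^-1 ^+ a).
have d0 : 0 < d / 2 by rewrite divr_gt0 // lt_min !subr_gt0 near.
have [b bP] := exp2V_small d0; have {}bP := bP b (leqnn b).
have b0 : 0 < 2^-1 ^+ b :> R by rewrite exprn_gt0 // invr_gt0.
have [v vP] := ideal_dense mu b0.
have d1 : d <= nnrat R q - prokhorov (ideal_measure R u) mu by rewrite ge_min lexx.
have d2 : d <= pr mu [set y] - 2^-1 ^+ a by rewrite ge_min lexx orbT.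
exists (encode_seq [:: encode_ideal v; b; a; encode_ideal u; q.1; q.2; fuel]); last first.
  rewrite /cradius /distance !cnth_encode /= ideal_of_encode.
  by move: vP; rewrite exprVn -[_^-1]mul1r ltr_pdivlMr ?exprn_gt0 // mulrC.
rewrite /cgood !cnth_encode [nth _ _ _]/= [nth _ _ _]/=.
apply/and5P; split; [exact: cvalid_encode_word|exact: cvalid_encode_ideal|
  exact: cvalid_encode_ideal|exact: enum|apply/andP; split].
  have : prokhorov (ideal_measure R u) (ideal_measure R v) + 2^-1 ^+ b <= nnrat R q.
    have := prokhorov_triangle mu (ideal_measure R u) (ideal_measure R v).
    by rewrite (prokhorovC mu); lra.
  rewrite prokhorov_ideal exprVn -[X in _ + X]div1r -natrX addf_div; last 2 first.
  - by rewrite pnatr_eq0 -lt0n muln_gt0 !cden_gt0.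
  - by rewrite pnatr_eq0 -lt0n expn_gt0.
  rewrite /nnrat ler_pdivrMr; last by rewrite -natrM ltr0n !muln_gt0 !cden_gt0 expn_gt0.
  rewrite mulrAC ler_pdivlMr // mul1r -!natrM -natrD -!natrM ler_nat.
  by rewrite [(cden _ * cden _ * 2 ^ b)%N]mulnC.
have : 2^-1 ^+ a + 2^-1 ^+ b <= pr (ideal_measure R v) [set y].
  by have := pr_prokhorov mu (ideal_measure R v) [set y]; rewrite prokhorovC; lra.
rewrite pr_ideal1 !exprVn -[X in X + _]div1r -[X in _ + X]div1r addf_div ?expf_neq0 //.
rewrite ler_pdivrMr ?mulr_gt0 ?exprn_gt0 // mulrAC ler_pdivlMr ?ltr0n ?cden_gt0 //.
by rewrite !mul1r -exprD -!natrX -natrD -!natrM ler_nat.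
Qed.

(** The pieces below [n] lie in a cube of triples. For a fixed word and scale k the steps telescope
    to a ramp, which is at most 1 and vanishes unless 2^-k is below the mass of the word;
    [geometric_tail] then bounds the share of the word by its mass. Numbers that code no word have
    zero ramps. *)
Lemma left_end_le1 (mu : M) n : left_end good cradius (distance mu) n <= 1.
Proof.
set delta := distance mu; pose r := ramp good cradius delta.
pose F (x : nat) (a : nat * nat) := 2^-1 ^+ a.1.+1 * (r x a.1 a.2.+1 - r x a.1 a.2).
have F0 x a : 0 <= F x a.
  by rewrite mulr_ge0 ?exprn_ge0 ?invr_ge0 // subr_ge0 ramp_leS.
apply: (@le_trans _ _ (\sum_(x < n) \sum_(b < n) F x (nunpair b))).
  exact: (@sum_nunpair_le _ (fun a => F a.1 (nunpair a.2)) n (fun a => F0 _ _)).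
apply: (@le_trans _ _ (\sum_(x < n) \sum_(k < n) 2^-1 ^+ k.+1 * r x k n)).
  apply: ler_sum => x _; apply: le_trans (sum_nunpair_le _ (F0 x)) _.
  apply: ler_sum => k _; rewrite /F /= -mulr_sumr ler_wpM2l ?exprn_ge0 ?invr_ge0 //=.
  by rewrite -(big_mkord predT (fun j => r x k j.+1 - r x k j)) telescope_sumr //
    /r ramp0 subr0.
have [U [uU UE]] := words_below Sigma n.
apply: le_trans (mass_sum mu uU).
pose G (x : nat) := \sum_(k < n) 2^-1 ^+ k.+1 * r x k n.
have G0 x : 0 <= G x.
  by apply: sumr_ge0 => k _; rewrite mulr_ge0 ?ramp_ge0 ?exprn_ge0 ?invr_ge0.
have -> : \sum_(x < n) \sum_(k < n) 2^-1 ^+ k.+1 * r x k n =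
    \sum_(x <- [seq encode_word y | y <- U]) G x.
  rewrite -(big_mkord predT G) (bigID (mem [seq encode_word y | y <- U])) /=.
  rewrite [X in _ + X]big_nat_cond [X in _ + X]big1 ?addr0; last first.
    move=> x /andP[/andP[_ xn] xU]; apply: big1 => k _.
    case: (ltgtP 0 (r x k n)) (ramp_ge0 good cradius delta x k n) => // [rx _|<-];
      last by rewrite mulr0.
    have [i gi lt] := ramp_gt0_inv rx; have [y yx _] := good_sound gi lt.
    by case/mapP: xU; exists y; rewrite ?UE ?yx.
  rewrite -big_filter; apply/perm_big/uniq_perm.
  - by rewrite filter_uniq ?iota_uniq.
  - by rewrite map_inj_uniq //; exact: encode_word_inj.
  move=> x; rewrite mem_filter mem_index_iota /=; apply: andb_idr.
  by case/mapP => y; rewrite UE => lt ->.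
rewrite big_map; apply: ler_sum => y _.
have := geometric_tail n (mass_ge0 mu y); rewrite le_min => /andP[_].
apply: le_trans; apply: ler_sum => k _; case: ltP => lt; rewrite ?mul1r ?mul0r.
  by rewrite ler_piMr ?exprn_ge0 ?invr_ge0 // ramp_le1.
rewrite (_ : r _ _ _ = 0) ?mulr0 //; apply/eqP; rewrite eq_le ramp_ge0 andbT leNgt.
apply/negP => /ramp_gt0_inv[i gi /(good_sound gi)[z /encode_word_inj ->]].
by rewrite ltNge lt.
Qed.

Local Notation left mu := (left_end good cradius (distance mu)).
Local Notation left_approx z M := (cleft good cradius (cfloor (z M) M) M).

(** One 2^-m for replacing [mu] by the entry [z m], and one for rounding down. Goodness ensures that
    the center of [i] is the code of an ideal measure. *)
Lemma cfloor_close (mu : M) z m x k i : name z mu -> good x k i ->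
  `|distance mu i - (cfloor (z m) m i)%:R / 2 ^+ m| <= 2 / 2 ^+ m.
Proof.
move=> /name_dist[s [zs near]] /and5P[_ /cvalid_idealP[v vE] _ _ _].
rewrite /distance /cfloor -vE ideal_of_encode zs.
have := near m; rewrite exprVn; set d := prokhorov _ mu => dm.
have := prokhorov_triangle (ideal_measure R (s m)) (ideal_measure R v) mu.
have := prokhorov_triangle mu (ideal_measure R v) (ideal_measure R (s m)).
rewrite (prokhorovC mu) -/d prokhorov_ideal.
set N := cdist _ _; set Q := (_ * _)%N => le1 le2.
have Q0 : 0 < Q%:R :> R by rewrite ltr0n muln_gt0 !cden_gt0.
have m0 : 0 < 2 ^+ m :> R by rewrite exprn_gt0.
have lo : ((2 ^ m * N) %/ Q)%N%:R / 2 ^+ m <= N%:R / Q%:R :> R.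
  rewrite ler_pdivrMr // mulrAC ler_pdivlMr // -natrX -!natrM ler_nat.
  by rewrite [leqRHS]mulnC leq_divM.
have hi : N%:R / Q%:R <= ((2 ^ m * N) %/ Q)%N%:R / 2 ^+ m + 1 / 2 ^+ m :> R.
  rewrite -mulrDl natr1 ler_pdivrMr // mulrAC ler_pdivlMr // -natrX -!natrM ler_nat.
  by rewrite [leqLHS]mulnC ltnW // ltn_ceil // -(ltr0n R).
by rewrite ler_norml; lra.
Qed.

Lemma left_close (mu : M) z m n i : name z mu -> (i <= n.+1)%N ->
  `|left mu i - (left_approx z m n.+1 i)%:R / 2 ^+ (m + n.+1)| <=
  (2 * 16 ^ n.+1)%:R / 2 ^+ m.
Proof.
move=> nz ni; rewrite -(cleftE R good cradius _ _ ni).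
have e0 : 0 <= 2 / 2 ^+ m :> R by rewrite divr_ge0 ?exprn_ge0.
apply: le_trans (left_end_lipschitz cradius_le i _ e0) _.
  by move=> x k j; exact: cfloor_close.
rewrite natrM natrX [leRHS]mulrAC [leRHS]mulrC ler_wpM2r // ler_weXn2l //.
by rewrite ler1n.
Qed.

Lemma cinsideE z p n m : cinside Sigma c z (encode_prog p) (npair n m) <->
  [/\ size p = (piece_scale n + 5)%N,
      (left_approx z m n.+1 n)%:R / 2 ^+ (m + n.+1) + (2 * 16 ^ n.+1)%:R / 2 ^+ m
        < (bval p)%:R / 2 ^+ size p :> R &
      (bval p).+1%:R / 2 ^+ size p + (2 * 16 ^ n.+1)%:R / 2 ^+ m
        < (left_approx z m n.+1 n.+1)%:R / 2 ^+ (m + n.+1) :> R].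
Proof.
rewrite /cinside npairK /= clen_encode size_map cval_encode.
have E : (2 * 16 ^ n.+1)%:R / 2 ^+ m = (2 * 16 ^ n.+1 * 2 ^ n.+1)%:R / 2 ^+ (m + n.+1) :> R.
  by rewrite exprD [in RHS]natrM [(2 ^ _)%:R]natrX -[RHS]mulf_div divff ?mulr1 // expf_neq0.
rewrite E -mulrDl -natrD dyadic_lt addf_div ?expf_neq0 //.
set X := (2 * 16 ^ n.+1 * 2 ^ n.+1)%N; set a := cleft _ _ _ _ _ n.+1.
rewrite -(_ : (a * 2 ^ size p)%:R / (2 ^+ size p * 2 ^+ (m + n.+1)) =
  a%:R / 2 ^+ (m + n.+1) :> R); last first.
  by rewrite natrM natrX [X in X / _]mulrC -[LHS]mulf_div divff ?mul1r // expf_neq0.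
rewrite ltr_pM2r ?invr_gt0 ?mulr_gt0 ?exprn_gt0 // -!natrX -!natrM -natrD ltr_nat.
by split=> [/and3P[/eqP]|[->]] // -> ->; rewrite eqxx.
Qed.

(** A step of at least 1/4 at scale k gives a piece of width at least 2^-(k+3) = 4 * 2^-(k+5),
    enough for a cell of length k + 5 by [inside_exists]. As the length depends only on the piece,
    no program of a piece properly extends another one. *)
Definition codes (p : seq bool) (mu : M) (x : W) : Prop := exists n,
  [/\ size p = (piece_scale n + 5)%N, inside p (left mu n) (left mu n.+1) &
    encode_word x = piece_word n].

(** A piece that contains a cell has positive width, hence a positive ramp and a good index, and
    good indices exist only for codes of words. *)
Lemma inside_word (mu : M) p n : inside p (left mu n) (left mu n.+1) ->
  exists x : W, encode_word x = piece_word n.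
Proof.
move=> [lo hi]; have lt : left mu n < left mu n.+1.
  apply: (lt_trans lo); apply: le_lt_trans hi.
  by rewrite ler_pM2r ?invr_gt0 ?exprn_gt0 // ler_nat.
move: lt; rewrite left_endS ltrDl => piece0.
have : 0 < ramp good cradius (distance mu) (piece_word n) (piece_scale n) (piece_step n).+1.
  rewrite lt_def ramp_ge0 andbT; apply: contraTneq piece0 => r0.
  rewrite /piece r0 sub0r -leNgt mulr_ge0_le0 ?exprn_ge0 ?invr_ge0 //.
  by rewrite oppr_le0 ramp_ge0.
by move=> /ramp_gt0_inv[i gi /(good_sound gi)[x xE _]]; exists x.
Qed.

Lemma inside_prefix_index (mu : M) p q m n : prefix p q ->
  inside p (left mu m) (left mu m.+1) -> inside q (left mu n) (left mu n.+1) -> m = n.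
Proof.
move=> pq pm qn; have [lt1 lt2] := inside_prefix pq pm qn.
have mono i j : (i < j)%N -> left mu i.+1 <= left mu j by exact: left_end_homo.
case: (ltngtP m n) => // /mono; first by rewrite leNgt lt2.
by rewrite leNgt lt1.
Qed.

Lemma codes_functional p (mu : M) x y : codes p mu x -> codes p mu y -> x = y.
Proof.
move=> [m [_ pm xm]] [n [_ pn yn]]; apply: encode_word_inj.
by rewrite xm yn (inside_prefix_index (prefix_refl p) pm pn).
Qed.

Lemma codes_interpreter : interpreter (rel_interpreter codes).
Proof.
have codesP p (mu : M) x : rel_interpreter codes p mu = Some x <-> codes p mu x.
  by apply: rel_interpreterP; exact: codes_functional.
apply: (interpreter_search (rec_cinside Sigma c)
  (out := fun o e => piece_word (nunpair (nunpair e).2).1)).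
- by rewrite /piece_word; rec_auto.
- move=> mu z nz p w; rewrite -(nunpairK w).
  move: (nunpair w).1 (nunpair w).2 => n m /cinsideE[psize lo hi].
  have := left_close m nz (leqnSn n); have := left_close m nz (leqnn n.+1).
  rewrite !ler_norml => b1 b2.
  have pin : inside p (left mu n) (left mu n.+1) by split; lra.
  have [x xE] := inside_word pin; exists x; last by rewrite !npairK.
  by apply/codesP; exists n.
- move=> mu z nz p x /codesP[n [psize [lo hi] xE]].
  pose g := Num.min ((bval p)%:R / 2 ^+ size p - left mu n)
                    (left mu n.+1 - (bval p).+1%:R / 2 ^+ size p).
  have g0 : 0 < g by rewrite lt_min !subr_gt0 lo hi.
  (* The gap has to exceed twice the bound 2 * 16^(n+1) / 2^m: once for the actual error of the end
     points and once for the margin that [cinside] demands. *)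
  have [m mP] := exp2V_small (divr_gt0 g0 (ltr0Sn R (4 * 16 ^ n.+1)%N)).
  exists (npair n m); apply/cinsideE.
  have := mP m (leqnn m); rewrite ltr_pdivlMr // exprVn mulrC => gm.
  have em : 2 * ((2 * 16 ^ n.+1)%:R / 2 ^+ m) < g.
    apply: le_lt_trans gm; rewrite mulrA ler_pM2r ?invr_gt0 ?exprn_gt0 //.
    by rewrite -natrM ler_nat; lia.
  have := left_close m nz (leqnSn n); have := left_close m nz (leqnn n.+1).
  have g1 : g <= (bval p)%:R / 2 ^+ size p - left mu n by rewrite ge_min lexx.
  have g2 : g <= left mu n.+1 - (bval p).+1%:R / 2 ^+ size p.
    by rewrite ge_min lexx orbT.
  by rewrite !ler_norml => *; split; [exact: psize | lra | lra].
- move=> mu p q /rel_interpreter_defined[x [m [pm pin _]]].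
  move=> /rel_interpreter_defined[y [n [qn qin _]]] pq.
  have mn := inside_prefix_index pq pin qin.
  move: pq => /prefixP[r qE]; move: qn; rewrite qE size_cat pm mn => /eqP.
  by rewrite -[X in _ == X]addn0 eqn_add2l => /nilP ->; rewrite cats0.
Qed.

(** For a mass in the interval from 2^-a to 2 * 2^-a, [good_complete] applies at scale a + 2, so the
    program has length a + 7, and 2 * 2^-a = 256 * 2^-(a+7). *)
Lemma codes_short (mu : M) x : 0 < mass mu x ->
  exists2 p, codes p mu x & mass mu x <= 256 * 2^-1 ^+ size p.
Proof.
move=> m0; have [a [am ma]] := dyadic_scale m0 (mass_le1 _ _).
have lt : 4 * 2^-1 ^+ a.+2 < mass mu x by rewrite !exprS; lra.
have [i gi near] := good_complete lt.
have [j step] := ramp_step (ramp_gt0 gi near).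
pose n := npair (encode_word x) (npair a.+2 j).
have big : 4 * 2^-1 ^+ (a.+2 + 5) <= left mu n.+1 - left mu n.
  rewrite left_endS addrC addKr /piece /piece_word /piece_scale /piece_step !npairK /=.
  have p0 : 0 <= 2^-1 ^+ a.+3 :> R by rewrite exprn_ge0 ?invr_ge0.
  apply: le_trans (ler_wpM2l p0 step); rewrite exprD !exprS; lra.
have [p pl pin] := inside_exists (left_end_ge0 _ _ _ _) (left_end_le1 mu n.+1) big.
exists p; last by rewrite pl exprD !exprS; lra.
by exists n; split=> //; rewrite ?pl /piece_scale /piece_word !npairK.
Qed.

End Coding.

(** * Combination of the two bounds *)

Local Open Scope ring_scope.

Lemma log2eE (R : realType) (r : R) : 0 < r -> log2e r%:E = (ln r / ln 2)%:E.
Proof. by move=> r0; rewrite /log2e lne_EFin. Qed.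

Theorem theorem4p9 (R : realType) (Sigma : finType)
    (t : probability (word Sigma) R -> word Sigma -> \bar R)
    (T : seq bool -> probability (word Sigma) R -> option (word Sigma))
    (t_universal : universal_test t) (T_optimal : optimal_interpreter T) :
  exists c : R, forall (mu : probability (word Sigma) R) (x : word Sigma),
    (abs_diff (log2e (t mu x))
       (- log2e (mu [set x]) - complexity T x mu) <= c%:E)%E.
Proof.
have [[t_ge0 [S S_ce tS] t_sum] t_max] := t_universal.
have [c0 c0P] := comp_enumerableP S_ce.
have t_enum (mu : probability (word Sigma) R) (x : word Sigma) (r : nat * nat) :
    ((nnrat R r)%:E < t mu x)%E <-> exists s q,
    (exists fuel, (0 < ev c0 (cnth 0) fuel (encode_seq
      [:: encode_word x; r.1; r.2; encode_ideal s; q.1; q.2]))%N) /\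
    prokhorov (ideal_measure R s) mu < nnrat R q.
  rewrite tS; split=> -[s [q [Ss near]]]; exists s, q;
    by split=> //; exact/c0P.
have [c1 Tc1] := T_optimal.2 _ (codes_interpreter t_ge0 t_sum t_enum).
have [P PP] := shortest_program_ex T_optimal.
have PT a : T (P a) a.1 = Some a.2 by have [] := PP a.
have Pmin a q : T q a.1 = Some a.2 -> (size (P a) <= size q)%N by have [_ _] := PP a; apply.
have [C C0 Ct] := t_max _ (kraft_test_is_test T_optimal PT Pmin).
have ln2 : 0 < ln 2 :> R by rewrite ln_gt0 // ltr1n.
(* The first term is the price of domination by the universal test, the second comes from
   [codes_short], and the third from the optimality of [T]. *)
exists (`|ln C / ln 2| + `|ln 256 / ln 2| + `|c1|) => mu x.
have c_ge0 : 0 <= `|ln C / ln 2| + `|ln 256 / ln 2| + `|c1| by rewrite !addr_ge0.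
have TE : complexity T x mu = (size (P (mu, x)))%:R%:E by have [] := PP (mu, x).
have := Ct mu x; rewrite /kraft_test prE TE; case: eqP => [->|/eqP m0].
  (* At probability 0 domination makes the test infinite. The other side is [+oo] minus a finite
     complexity, and [abs_diff] is 0 by its convention. *)
  rewrite gt0_muley ?lte_fin // leye_eq => /eqP ->.
  rewrite /abs_diff /log2e [lne +oo]/= (le0_lneNy (lexx 0%E)) gt0_mulye ?lte_fin ?invr_gt0 //.
  by rewrite gt0_mulNye ?lte_fin ?invr_gt0 //= eqxx lee_fin.
have {}m0 : 0 < pr mu [set x] by rewrite lt_def m0 pr_ge0.
have [r tr mr] := mass_gt0_test t_ge0 t_sum m0.
rewrite tr -EFinM lee_fin; set h := size _ => Cr.
have h0 : 0 < 2^-1 ^+ h :> R by rewrite exprn_gt0 // invr_gt0.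
have Cm : C * 2^-1 ^+ h <= mass t mu x.
  by rewrite mr [leRHS]mulrC -ler_pdivrMr // -mulrA.
have mass0 : 0 < mass t mu x by apply: lt_le_trans Cm; rewrite mulr_gt0.
have r0 : 0 < r by move: mass0; rewrite mr pmulr_rgt0.
have [p px mp] := codes_short t_ge0 t_sum t_enum mass0.
have hp : h%:R <= (size p)%:R + c1.
  have := Tc1 mu x; rewrite TE => le; rewrite -lee_fin; apply: (le_trans le).
  rewrite EFinD leeD2r // complexity_le //; apply/rel_interpreterP => // y z.
  exact: codes_functional.
have lnV n : ln (2^-1 ^+ n) = - (n%:R * ln 2) :> R.
  by rewrite lnXn ?invr_gt0 // lnV ?posrE // mulNrn mulr_natl.
have lo : ln C - h%:R * ln 2 <= ln (mass t mu x).
  by rewrite -lnV -lnM ?posrE // ler_ln ?posrE // mulr_gt0.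
have hi : ln (mass t mu x) <= ln 256 - (size p)%:R * ln 2.
  have p0 : 0 < 2^-1 ^+ size p :> R by rewrite exprn_gt0 // invr_gt0.
  by rewrite -lnV -lnM ?posrE // ler_ln ?posrE // mulr_gt0.
rewrite !log2eE // -EFinN -!EFinB /abs_diff; case: ifP => _; first by rewrite lee_fin.
rewrite -EFinB lee_fin.
(* Moving log mu(x) to the test turns the difference into log(mu(x) t_mu(x)) + H(x|mu), which [lo]
   and [hi] bound from the two sides. *)
have -> : ln r / ln 2 - (- (ln (pr mu [set x]) / ln 2) - h%:R) =
    ln (mass t mu x) / ln 2 + h%:R.
  by rewrite mr lnM ?posrE // mulrDl; ring.
have lo' : ln C / ln 2 <= ln (mass t mu x) / ln 2 + h%:R.
  by rewrite -lerBlDr ler_pdivlMr // mulrBl divfK ?gt_eqF.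
have hi' : ln (mass t mu x) / ln 2 <= ln 256 / ln 2 - (size p)%:R.
  by rewrite ler_pdivrMr // mulrBl divfK ?gt_eqF.
rewrite ler_norml.
have := ler_norm (ln 256 / ln 2 : R); have := ler_norm c1.
have := ler_norm (- (ln C / ln 2)); rewrite normrN.
have := normr_ge0 (ln C / ln 2); have := normr_ge0 (ln 256 / ln 2 : R).
have := normr_ge0 c1; lra.
Qed.
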